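(* For every $\ell\in\mathbb{N}$, the ratio $\frac{B_{2\ell}(s)}{B_{2\ell-1}(s)}$ increases in $s\in\bigl(0,\frac12\bigr)$ and increases in $s\in\bigl(\frac12,1\bigr)$. For each fixed $s\in\bigl(0,\frac12\bigr)$, the sequence $\frac{B_{2\ell}(s)}{\ell B_{2\ell-1}(s)}$ decreases in $\ell\in\mathbb{N}$; for each fixed $s\in\bigl(\frac12,1\bigr)$, the sequence $\frac{B_{2\ell}(s)}{\ell B_{2\ell-1}(s)}$ increases in $\ell\in\mathbb{N}$. In both cases, $$\lim_{\ell\to\infty}\frac{B_{2\ell}(s)}{\ell B_{2\ell-1}(s)}=-\frac{\cot(2\pi s)}{\pi}.$$
   Context: $\mathbb{N}=\{1,2,\dots\}$. The Bernoulli polynomials $B_\ell(s)$, $\ell\in\{0,1,2,\dots\}$, are defined by $\frac{z e^{sz}}{e^z-1}=\sum_{\ell=0}^\infty B_\ell(s)\frac{z^\ell}{\ell!}$ for $|z|<2\pi$. *)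

(* Defs.v *)
From Stdlib Require Import Reals Factorial.
From Coquelicot Require Import Coquelicot.
Open Scope R_scope.

Definition Cexp (z : C) : C :=
  (exp (Re z) * cos (Im z), exp (Re z) * sin (Im z)).

Definition cot (x : R) : R := cos x / sin x.

(* [B l s] is the value at [s] of the [l]-th Bernoulli polynomial.  The
   expansion determines [B] uniquely.  The point [z = 0], where the quotient
   has a removable singularity, is left out because [0 / 0 = 0] in [C]. *)
Definition Bernoulli_polynomials (B : nat -> R -> R) : Prop :=
  forall (s : R) (z : C), z <> 0%C -> Cmod z < 2 * PI ->
    @is_pseries C_AbsRing C_NormedModule
      (fun l => RtoC (B l s / INR (fact l))) z
      (z * Cexp (RtoC s * z) / (Cexp z - 1))%C.

Definition strictly_increasing_on (a b : R) (f : R -> R) : Prop :=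
  forall x y : R, a < x -> x < y -> y < b -> f x < f y.

(* Main.v *)
(* Put b_n = B_n / n!, so that b_n' = b_(n-1), and x = 2 pi s.  The Fourier
   expansions of b_n turn b_(2l) / b_(2l-1) on (0, 1/2) into
   - A_(2l)(1) / (2 pi S_(2l-1)(1)), where A_n(q) and S_n(q) are the sums over
   k >= 1 of q^k cos(k x) / k^n and q^k sin(k x) / k^n.  As q A_(n+1)' = A_n,
   q S_(n+1)' = S_n and everything vanishes at q = 0, the monotone form of
   l'Hopital's rule shows that if A_n / S_(n-1) decreases on (0, 1], so does
   A_(n+1) / S_n, and that A_(n+1) / S_n > A_n / S_(n-1) at q = 1.  The base
   case A_1 / S_0 is elementary and reduces to ln w <= w - 1.  This gives the
   monotonicity in l; the limit follows from A_n(1) -> cos x and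
   S_n(1) -> sin x.

   The derivative in s of b_(2l) / b_(2l-1) has the sign of the Turan
   determinant b_(2l-1)^2 - b_(2l) b_(2l-2), which is positive at s = 1/2 and
   decreasing on (0, 1/2), its derivative being controlled by the monotonicity
   in l.  The reflection s -> 1 - s settles the interval (1/2, 1). *)
Require Import Defs.
From Stdlib Require Import Reals Factorial Lra Lia.
From Coquelicot Require Import Coquelicot.
Open Scope R_scope.

(* [ring] and [lra] do not see through Coquelicot's carrier types. *)
Ltac real_eq := lazymatch goal with |- @eq _ ?x ?y => change (@eq R x y) end.

(** * Bernoulli polynomials from the generating function *)

(** Beyond the radius of convergence the terms do not tend to 0, so convergence at [r'] bounds the
    radius below by [r']. *)
Lemma CV_radius_gt (a : nat -> R) (r r' : R) :
  0 <= r < r' -> ex_pseries a r' -> Rbar_lt r (CV_radius a).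
Proof.
  intros [Hr Hr'] Ha.
  apply Rbar_lt_le_trans with (Finite r'); [exact Hr'|].
  destruct (Rbar_le_lt_dec r' (CV_radius a)) as [|H]; [assumption|exfalso].
  apply (CV_disk_outside a r').
  - now rewrite (Rabs_pos_eq r') by lra.
  - apply ex_series_lim_0.
    revert Ha; apply ex_series_ext; intros n.
    rewrite pow_n_pow; unfold scal; simpl; unfold mult; simpl; ring.
Qed.

(** The point 0 is left out because the generating function is only known off 0; continuity of both
    power series recovers their common value there. The identities between Bernoulli polynomials
    below come from comparing coefficients in this way. *)
Lemma pseries_unique_punctured (a b : nat -> R) (f : R -> R) :
  (forall t, 0 < Rabs t < 1 -> is_pseries a t (f t) /\ is_pseries b t (f t)) ->
  forall n, a n = b n.
Proof.
  intros H n.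
  assert (Hh : 0 < Rabs (1 / 2) < 1) by (rewrite Rabs_pos_eq; lra).
  assert (Ra : Rbar_lt 0 (CV_radius a)).
  { apply CV_radius_gt with (1 / 2); [lra|]; eexists; apply (H _ Hh). }
  assert (Rb : Rbar_lt 0 (CV_radius b)).
  { apply CV_radius_gt with (1 / 2); [lra|]; eexists; apply (H _ Hh). }
  assert (Heq : forall t, 0 < Rabs t < 1 -> PSeries a t = PSeries b t).
  { intros t Ht; destruct (H t Ht) as [H1 H2].
    now rewrite (is_pseries_unique _ _ _ H1), (is_pseries_unique _ _ _ H2). }
  assert (H0 : PSeries a 0 = PSeries b 0).
  { assert (Ca : continuity_pt (PSeries a) 0).
    { apply PSeries_continuity; now rewrite Rabs_R0. }
    assert (Cb : continuity_pt (PSeries b) 0).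
    { apply PSeries_continuity; now rewrite Rabs_R0. }
    apply is_lim_continuity in Ca; apply is_lim_continuity in Cb.
    apply is_lim_unique in Cb.
    cut (is_lim (PSeries b) 0 (PSeries a 0)).
    { intros H1; apply is_lim_unique in H1; rewrite Cb in H1; now injection H1. }
    revert Ca; apply is_lim_ext_loc.
    exists (mkposreal 1 Rlt_0_1); intros t Ht Ht0; apply Heq.
    split; [now apply Rabs_pos_lt|].
    revert Ht; unfold ball; simpl; unfold AbsRing_ball, abs, minus, plus, opp; simpl.
    now rewrite Ropp_0, Rplus_0_r. }
  apply PSeries_ext_recip; trivial.
  exists (mkposreal 1 Rlt_0_1); intros t Ht.
  destruct (Req_dec t 0) as [->|Ht0]; [exact H0|apply Heq].
  split; [now apply Rabs_pos_lt|].
  revert Ht; unfold ball; simpl; unfold AbsRing_ball, abs, minus, plus, opp; simpl.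
  now rewrite Ropp_0, Rplus_0_r.
Qed.

Lemma Cexp_RtoC (r : R) : Cexp (RtoC r) = RtoC (exp r).
Proof.
  unfold Cexp, RtoC; simpl; rewrite cos_0, sin_0; f_equal; ring.
Qed.

Lemma exp_neq_1 (t : R) : t <> 0 -> exp t - 1 <> 0.
Proof.
  intros Ht H; apply Ht, exp_inv; rewrite exp_0; lra.
Qed.

Lemma sum_n_RtoC (u : nat -> R) (n : nat) :
  sum_n (fun k => RtoC (u k)) n = RtoC (sum_n u n).
Proof.
  induction n as [|n IH]; [now rewrite !sum_O|].
  rewrite !sum_Sn, IH; unfold plus; simpl; now rewrite RtoC_plus.
Qed.

Lemma is_series_RtoC (u : nat -> R) (l : R) :
  @is_series C_AbsRing C_NormedModule (fun k => RtoC (u k)) (RtoC l) ->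
  is_series u l.
Proof.
  intros H; unfold is_series in *.
  apply filterlim_locally; intros eps.
  generalize (proj1 (filterlim_locally _ _) H eps).
  apply filter_imp; intros n Hn.
  rewrite sum_n_RtoC in Hn; apply Hn.
Qed.

Definition bern (B : nat -> R -> R) (n : nat) (s : R) : R :=
  B n s / INR (fact n).

(** The defining expansion restricted to the real axis, which already determines all the
    coefficients. *)
Lemma bern_pseries (B : nat -> R -> R) (HB : Bernoulli_polynomials B)
  (s t : R) : t <> 0 -> Rabs t < 2 * PI ->
  is_pseries (fun n => bern B n s) t (t * exp (s * t) / (exp t - 1)).
Proof.
  intros Ht Ht2.
  assert (Htc : RtoC t <> 0%C) by (intros H; apply Ht; now injection H).
  assert (Ht3 : Cmod (RtoC t) < 2 * PI) by now rewrite Cmod_R.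
  generalize (HB s (RtoC t) Htc Ht3).
  rewrite <- RtoC_mult, !Cexp_RtoC, <- RtoC_mult, <- RtoC_minus, <- RtoC_div
    by now apply exp_neq_1.
  intros H; apply is_series_RtoC; refine (is_series_ext _ _ _ _ H); intros n.
  replace (@pow_n C_AbsRing (RtoC t) n) with (RtoC (t ^ n)).
  2:{ induction n as [|n IH]; [reflexivity|].
      simpl; rewrite <- IH; unfold mult; simpl; now rewrite RtoC_mult. }
  symmetry; exact (RtoC_mult (t ^ n) (bern B n s)).
Qed.

Definition exp_coef (s : R) (n : nat) : R := s ^ n / INR (fact n).

Lemma exp_coef_pseries (s t : R) : is_pseries (exp_coef s) t (exp (s * t)).
Proof.
  apply is_pseries_R.
  generalize (proj1 (is_pseries_R _ _ _) (is_exp_Reals (s * t))).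
  apply is_series_ext; intros n; real_eq.
  unfold exp_coef, Rdiv; rewrite Rpow_mult_distr; ring.
Qed.

(** The generating function at [s] is the one at 0 times [exp (s * t)], so its coefficients form a
    Cauchy product. This exhibits [bern B n] as a polynomial in [s]. *)
Lemma bern_exp_coef (B : nat -> R -> R) (HB : Bernoulli_polynomials B)
  (s : R) (n : nat) :
  bern B n s = PS_mult (fun k => bern B k 0) (exp_coef s) n.
Proof.
  revert n; apply (pseries_unique_punctured (fun n => bern B n s) _
    (fun t => t * exp (s * t) / (exp t - 1))).
  generalize PI2_1; intros HPI t [Ht0 Ht1].
  assert (Ht : t <> 0) by (intros ->; rewrite Rabs_R0 in Ht0; lra).
  split; [apply bern_pseries; trivial; lra|].
  replace (t * exp (s * t) / (exp t - 1))
    with (t * exp (0 * t) / (exp t - 1) * exp (s * t)).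
  2:{ rewrite Rmult_0_l, exp_0; field; now apply exp_neq_1. }
  assert (R1 : Rbar_lt (Rabs t) (CV_radius (fun k => bern B k 0))).
  { apply CV_radius_gt with 1; [split; [apply Rabs_pos|lra]|].
    eexists; apply bern_pseries; trivial; rewrite ?Rabs_R1; lra. }
  assert (R2 : Rbar_lt (Rabs t) (CV_radius (exp_coef s))).
  { apply CV_radius_gt with 1; [split; [apply Rabs_pos|lra]|]; eexists; apply exp_coef_pseries. }
  apply is_pseries_mult; trivial.
  - apply bern_pseries; trivial; lra.
  - apply exp_coef_pseries.
Qed.

(** The generating function is unchanged when [s] becomes [1 - s] and [t] becomes [- t]. *)
Lemma bern_reflection (B : nat -> R -> R) (HB : Bernoulli_polynomials B)
  (n : nat) (s : R) : bern B n (1 - s) = (-1) ^ n * bern B n s.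
Proof.
  revert n; apply (pseries_unique_punctured (fun n => bern B n (1 - s))
    (fun n => (-1) ^ n * bern B n s)
    (fun t => t * exp ((1 - s) * t) / (exp t - 1))).
  generalize PI2_1; intros HPI t [Ht0 Ht1].
  assert (Ht : t <> 0) by (intros ->; rewrite Rabs_R0 in Ht0; lra).
  split; [apply bern_pseries; trivial; lra|].
  assert (Hmt : - t <> 0) by lra.
  replace (t * exp ((1 - s) * t) / (exp t - 1))
    with (- t * exp (s * - t) / (exp (- t) - 1)).
  2:{ replace ((1 - s) * t) with (t + s * - t) by ring.
      rewrite (exp_plus t), (exp_Ropp t).
      generalize (exp_neq_1 _ Ht) (exp_pos t); intros; field; lra. }
  assert (H : is_pseries (fun n => bern B n s) (- t)
    (- t * exp (s * - t) / (exp (- t) - 1))).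
  { apply bern_pseries; trivial; rewrite Rabs_Ropp; lra. }
  apply is_pseries_R; apply is_pseries_R in H.
  revert H; apply is_series_ext; intros n; real_eq.
  replace (- t) with (-1 * t) by ring; rewrite Rpow_mult_distr; ring.
Qed.

(** The generating functions at [s = 1] and [s = 0] differ by exactly [t]. *)
Lemma bern_diff (B : nat -> R -> R) (HB : Bernoulli_polynomials B) (n : nat) :
  bern B n 1 - bern B n 0 = if Nat.eqb n 1 then 1 else 0.
Proof.
  revert n; apply (pseries_unique_punctured
    (fun n => bern B n 1 - bern B n 0)
    (fun n => if Nat.eqb n 1 then 1 else 0) (fun t => t)).
  generalize PI2_1; intros HPI t [Ht0 Ht1].
  assert (Ht : t <> 0) by (intros ->; rewrite Rabs_R0 in Ht0; lra).
  split.
  - replace t with (t * exp (1 * t) / (exp t - 1)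
      - t * exp (0 * t) / (exp t - 1)) at 2.
    2:{ rewrite Rmult_0_l, Rmult_1_l, exp_0; field; now apply exp_neq_1. }
    apply (is_pseries_minus (fun n => bern B n 1) (fun n => bern B n 0));
      apply bern_pseries; trivial; lra.
  - apply is_pseries_R.
    (* Once the terms of index 0 and 1 are removed, a zero series with sum 0 remains. *)
    apply is_series_decr_1, is_series_decr_1.
    replace (plus _ _) with 0.
    2:{ unfold plus, opp, scal, mult, one; simpl; unfold mult; simpl; ring. }
    unfold is_series; apply filterlim_ext with (fun _ => 0).
    + intros k; symmetry.
      rewrite (sum_n_ext _ (fun _ => 0)).
      * rewrite sum_n_const; real_eq; ring.
      * intros j; simpl; real_eq; ring.
    + apply filterlim_const.
Qed.

Lemma exp_coef_derive (n : nat) (s : R) :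
  is_derive (fun t => exp_coef t (S n)) s (exp_coef s n).
Proof.
  generalize (INR_fact_neq_0 n) (not_0_INR (S n) (Nat.neq_succ_0 n)).
  unfold exp_coef; rewrite fact_simpl, mult_INR.
  intros Ha Hb; unfold Rdiv; set (c := / (INR (S n) * _)).
  auto_derive; trivial.
  change (match n with 0%nat => 1 | S _ => INR n + 1 end) with (INR (S n)).
  change (pred (S n)) with n; unfold c; field; split; assumption.
Qed.

Lemma bern_derive (B : nat -> R -> R) (HB : Bernoulli_polynomials B)
  (n : nat) (s : R) : is_derive (bern B (S n)) s (bern B n s).
Proof.
  rewrite (bern_exp_coef B HB s n); unfold PS_mult; rewrite <- sum_n_Reals.
  (* The last term of the Cauchy product is the constant [bern B (S n) 0]; it is split off so that
     every other term has a factor [exp_coef t (S _)]. *)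
  apply (is_derive_ext (fun t =>
    sum_n (fun k => bern B k 0 * exp_coef t (S (n - k))) n + bern B (S n) 0)).
  - intros t; rewrite (bern_exp_coef B HB t (S n)); unfold PS_mult.
    rewrite tech5, <- sum_n_Reals, Nat.sub_diag; real_eq.
    replace (exp_coef t 0) with 1 by (unfold exp_coef; simpl; field).
    rewrite Rmult_1_r.
    f_equal; apply sum_n_ext_loc; intros k Hk.
    now rewrite <- Nat.sub_succ_l.
  - rewrite <- (Rplus_0_r (sum_n _ _)).
    apply (is_derive_plus (V := R_NormedModule)); [|exact (is_derive_const (K := R_AbsRing) (V := R_NormedModule) _ s)].
    apply (is_derive_sum_n (V := R_NormedModule)
      (fun k t => bern B k 0 * exp_coef t (S (n - k)))); intros k _.
    apply (is_derive_scal (fun t => exp_coef t (S (n - k)))), exp_coef_derive.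
Qed.

(** By the Cauchy product [b_1] is affine with slope [b_0(0)], and [b_1(1) - b_1(0) = 1] fixes that
    slope. In the same way [b_2(1) = b_2(0)] fixes the constant term of [b_1] in the next lemma. *)
Lemma bern_0 (B : nat -> R -> R) (HB : Bernoulli_polynomials B) (s : R) :
  bern B 0 s = 1.
Proof.
  assert (H0 : forall t, bern B 0 t = bern B 0 0).
  { intros t; rewrite (bern_exp_coef B HB t 0); unfold PS_mult, exp_coef.
    simpl; field. }
  assert (H1 := bern_diff B HB 1); simpl in H1.
  rewrite (bern_exp_coef B HB 1 1), (bern_exp_coef B HB 0 1) in H1.
  unfold PS_mult, exp_coef in H1; simpl in H1.
  rewrite H0; lra.
Qed.

Lemma bern_1 (B : nat -> R -> R) (HB : Bernoulli_polynomials B) (s : R) :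
  bern B 1 s = s - 1 / 2.
Proof.
  assert (H1 : forall t, bern B 1 t = t + bern B 1 0).
  { intros t; rewrite (bern_exp_coef B HB t 1); unfold PS_mult, exp_coef.
    simpl; rewrite (bern_0 B HB); field. }
  assert (H2 := bern_diff B HB 2); simpl in H2.
  rewrite (bern_exp_coef B HB 1 2), (bern_exp_coef B HB 0 2) in H2.
  unfold PS_mult, exp_coef in H2; simpl in H2.
  rewrite (bern_0 B HB) in H2; rewrite H1; lra.
Qed.


(** * Polylogarithmic power series *)

(* The term of index [0] is set to [0]: the sums start at [k = 1]. *)
Definition wcoef (u : nat -> R) (n k : nat) : R :=
  match k with O => 0 | S _ => u k / INR k ^ n end.

Lemma INR_S_ge_1 (k : nat) : 1 <= INR (S k).
Proof. rewrite S_INR; generalize (pos_INR k); lra. Qed.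

Lemma Rabs_wcoef (u : nat -> R) (n k : nat) :
  (forall j, Rabs (u j) <= 1) -> Rabs (wcoef u n k) <= 1.
Proof.
  intros Hu; destruct k as [|k]; unfold wcoef; [rewrite Rabs_R0; lra|].
  assert (H := pow_R1_Rle _ n (INR_S_ge_1 k)).
  unfold Rdiv; rewrite Rabs_mult, Rabs_inv, (Rabs_pos_eq (_ ^ n)) by lra.
  apply Rmult_le_reg_r with (INR (S k) ^ n); [lra|].
  rewrite Rmult_assoc, Rinv_l by lra; specialize (Hu (S k)); lra.
Qed.

Lemma Rabs_wcoef_2 (u : nat -> R) (n k : nat) :
  (forall j, Rabs (u j) <= 1) -> (2 <= n)%nat ->
  Rabs (wcoef u n k) <= wcoef (fun _ => 1) 2 k.
Proof.
  intros Hu Hn; destruct k as [|k]; unfold wcoef; [rewrite Rabs_R0; lra|].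
  assert (H2 := pow_R1_Rle _ 2 (INR_S_ge_1 k)).
  assert (H := Rle_pow _ _ _ (INR_S_ge_1 k) Hn).
  unfold Rdiv; rewrite Rabs_mult, Rabs_inv, (Rabs_pos_eq (_ ^ n)) by lra.
  apply Rmult_le_compat; [apply Rabs_pos| |apply Hu|].
  - left; apply Rinv_0_lt_compat; lra.
  - apply Rinv_le_contravar; lra.
Qed.

(** From [k = 2] on, [1 / k^2] is at most [1 / (k - 1) - 1 / k], which telescopes. *)
Lemma ex_series_inv_sqr : ex_series (wcoef (fun _ => 1) 2).
Proof.
  apply ex_series_incr_1, ex_series_incr_1.
  apply (ex_series_le (V := R_CompleteNormedModule) _
    (fun k => / INR (S k) - / INR (S (S k)))).
  - intros k; unfold norm; simpl wcoef; unfold abs; simpl.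
    change (match k with 0%nat => 1 | S _ => INR k + 1 end) with (INR (S k)).
    generalize (INR_S_ge_1 k); generalize (INR (S k)); intros x Hx.
    rewrite Rabs_pos_eq.
    2:{ apply Rdiv_le_0_compat; nra. }
    apply Rminus_le_0.
    replace (_ - _) with (/ (x * (x + 1) * (x + 1))) by (field; lra).
    left; apply Rinv_0_lt_compat; repeat apply Rmult_lt_0_compat; lra.
  - exists 1.
    change (is_lim_seq (sum_n (fun k => / INR (S k) - / INR (S (S k)))) 1).
    apply (is_lim_seq_ext (fun n => 1 - / INR (S (S n)))).
    + intros n; induction n as [|n IH].
      * rewrite sum_O; simpl; lra.
      * rewrite sum_Sn, <- IH.
        change (1 - / INR (S (S (S n))) = 1 - / INR (S (S n))
          + (/ INR (S (S n)) - / INR (S (S (S n))))); lra.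
    + replace (Finite 1) with (Finite (1 - 0)) by (f_equal; ring).
      apply is_lim_seq_minus'; [apply is_lim_seq_const|].
      apply (is_lim_seq_incr_1 (fun n => / INR (S n))).
      apply (is_lim_seq_incr_1 (fun n => / INR n)).
      replace (Finite 0) with (Rbar_inv p_infty) by reflexivity.
      apply is_lim_seq_inv; [apply is_lim_seq_INR|discriminate].
Qed.

Lemma ex_series_wcoef (u : nat -> R) (n : nat) :
  (forall j, Rabs (u j) <= 1) -> (2 <= n)%nat -> ex_series (wcoef u n).
Proof.
  intros Hu Hn.
  apply (ex_series_le (V := R_CompleteNormedModule) _ (wcoef (fun _ => 1) 2)).
  - intros k; now apply Rabs_wcoef_2.
  - exact ex_series_inv_sqr.
Qed.

(** Weierstrass M-test: the remainder is dominated by that of [M], which does not depend on the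
    point. *)
Lemma CVU_Series (f : nat -> R -> R) (M : nat -> R) (c : R) (r : posreal) :
  ex_series M -> (forall k x, Boule c r x -> Rabs (f k x) <= M k) ->
  CVU (fun n x => sum_f_R0 (fun k => f k x) n)
    (fun x => Series (fun k => f k x)) c r.
Proof.
  intros HM Hf eps Heps.
  assert (HS := Series_correct _ HM).
  apply is_lim_seq_Reals in HS; destruct (HS eps Heps) as [N HN].
  exists N; intros n x Hn Hx.
  assert (Ha : ex_series (fun k => Rabs (f k x))).
  { apply (ex_series_le (V := R_CompleteNormedModule) _ M); trivial.
    intros k; unfold norm; simpl; unfold abs; simpl; rewrite Rabs_Rabsolu.
    now apply Hf. }
  rewrite (Series_incr_n (fun k => f k x) (S n))
    by (try apply ex_series_Rabs; trivial; lia).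
  simpl pred; rewrite Rplus_comm; unfold Rminus; rewrite Rplus_assoc.
  rewrite Rplus_opp_r, Rplus_0_r.
  apply Rle_lt_trans with (Series (fun k => M (S n + k)%nat)).
  - eapply Rle_trans; [apply Series_Rabs|apply Series_le].
    + now apply (ex_series_incr_n (fun k => Rabs (f k x))).
    + intros k; split; [apply Rabs_pos|now apply Hf].
    + now apply (ex_series_incr_n M).
  - specialize (HN n Hn); rewrite sum_n_Reals in HN; unfold Rdist in HN.
    rewrite (Series_incr_n M (S n)) in HN by (trivial; lia).
    simpl pred in HN; apply Rabs_def2 in HN; lra.
Qed.

Lemma continuity_sum_f_R0 (f : nat -> R -> R) (x : R) (n : nat) :
  (forall k, continuity_pt (f k) x) ->
  continuity_pt (fun y => sum_f_R0 (fun k => f k y) n) x.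
Proof.
  intros Hf; induction n as [|n IH]; simpl; [apply Hf|].
  now apply (continuity_pt_plus _ (f (S n))).
Qed.

Lemma continuity_Series (f : nat -> R -> R) (M : nat -> R) (x : R) :
  ex_series M -> (forall k y, Rabs (f k y) <= M k) ->
  (forall k, continuity (f k)) ->
  continuity_pt (fun y => Series (fun k => f k y)) x.
Proof.
  intros HM Hf Hc.
  apply (CVU_continuity (fun n y => sum_f_R0 (fun k => f k y) n) _ x
    (mkposreal 1 Rlt_0_1)).
  - now apply CVU_Series with M.
  - intros n y _; apply continuity_sum_f_R0; intros k; apply Hc.
  - apply Boule_center.
Qed.

Lemma sum_f_R0_derive (f f' : nat -> R -> R) (x : R) (n : nat) :
  (forall k, is_derive (f k) x (f' k x)) ->
  is_derive (fun y => sum_f_R0 (fun k => f k y) n) x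
    (sum_f_R0 (fun k => f' k x) n).
Proof.
  intros Hf; induction n as [|n IH]; simpl; [apply Hf|].
  apply (is_derive_plus (V := R_NormedModule) _ (f (S n))); trivial.
Qed.

Lemma ex_series_Un_cv (a : nat -> R) :
  ex_series a -> Un_cv (sum_f_R0 a) (Series a).
Proof.
  intros H; apply is_lim_seq_Reals.
  apply is_lim_seq_ext with (sum_n a); [intros n; apply sum_n_Reals|].
  exact (Series_correct _ H).
Qed.

Lemma is_derive_Series (f f' : nat -> R -> R) (M : nat -> R) (x : R) :
  ex_series M -> (forall k y, Rabs (f' k y) <= M k) ->
  (forall y, ex_series (fun k => f k y)) ->
  (forall k y, is_derive (f k) y (f' k y)) ->
  is_derive (fun y => Series (fun k => f k y)) x (Series (fun k => f' k x)).
Proof.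
  intros HM Hf' Hf Hd; apply is_derive_Reals.
  apply (CVU_derivable (fun n y => sum_f_R0 (fun k => f k y) n)
    (fun n y => sum_f_R0 (fun k => f' k y) n) _
    (fun y => Series (fun k => f' k y)) x (mkposreal 1 Rlt_0_1)).
  - now apply CVU_Series with M.
  - intros y _; apply ex_series_Un_cv, Hf.
  - intros n y _; apply is_derive_Reals, sum_f_R0_derive; intros k; apply Hd.
  - apply Boule_center.
Qed.

Lemma CV_radius_wcoef (u : nat -> R) (n : nat) (q : R) :
  (forall j, Rabs (u j) <= 1) -> Rabs q < 1 ->
  Rbar_lt (Rabs q) (CV_radius (wcoef u n)).
Proof.
  intros Hu Hq; assert (Hq0 := Rabs_pos q).
  (* The midpoint of [Rabs q] and 1 still lies in the unit disk, where a geometric series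
     dominates. *)
  apply CV_radius_gt with ((1 + Rabs q) / 2); [lra|].
  apply ex_pseries_R.
  apply (ex_series_le (V := R_CompleteNormedModule) _
    (fun k => ((1 + Rabs q) / 2) ^ k)).
  - intros k; unfold norm; simpl; unfold abs; simpl.
    rewrite Rabs_mult, (Rabs_pos_eq (_ ^ k)) by (apply pow_le; lra).
    rewrite <- (Rmult_1_l (_ ^ k)) at 2.
    apply Rmult_le_compat_r; [apply pow_le; lra|now apply Rabs_wcoef].
  - apply ex_series_geom; rewrite Rabs_pos_eq; lra.
Qed.

(** The operator [q d/dq] multiplies the coefficient of [q ^ k] by [k], which lowers the exponent of
    [k] in the denominator by one. *)
Lemma PSeries_wcoef_derive (u : nat -> R) (n : nat) (q : R) :
  (forall j, Rabs (u j) <= 1) -> 0 < q < 1 ->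
  is_derive (PSeries (wcoef u (S n))) q (PSeries (wcoef u n) q / q).
Proof.
  intros Hu Hq.
  replace (PSeries (wcoef u n) q / q)
    with (PSeries (PS_derive (wcoef u (S n))) q).
  - apply is_derive_PSeries, CV_radius_wcoef; trivial.
    rewrite Rabs_pos_eq; lra.
  - rewrite (PSeries_ext (wcoef u n) (PS_incr_1 (PS_derive (wcoef u (S n))))).
    + rewrite PSeries_incr_1; field; lra.
    + intros [|k]; [reflexivity|].
      unfold PS_incr_1, PS_derive, wcoef; real_eq.
      generalize (INR_S_ge_1 k); intros H; rewrite <- tech_pow_Rmult.
      field; split; [apply pow_nonzero|]; lra.
Qed.

(** The three-term recurrence of [cos (k x)] and [sin (k x)] for [c = cos x]; it makes their
    generating functions rational. *)
Definition trig_rec (c : R) (u : nat -> R) : Prop :=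
  forall k, u (S (S k)) = 2 * c * u (S k) - u k.

(** Multiplied by the characteristic polynomial of the recurrence, the partial sum collapses to its
    boundary terms. *)
Lemma trig_rec_sum (c q : R) (u : nat -> R) (N : nat) : trig_rec c u ->
  (1 - 2 * q * c + q * q) * sum_f_R0 (fun k => wcoef u 0 k * q ^ k) N
  = q * u 1%nat - q * q * u 0%nat - q ^ S N * u (S N) + q ^ S (S N) * u N.
Proof.
  intros Hu; induction N as [|N IH]; [simpl; ring|].
  rewrite tech5, Rmult_plus_distr_l, IH, Hu.
  unfold wcoef; rewrite pow_O, Rdiv_1_r; simpl; ring.
Qed.

(** The upper boundary terms in [trig_rec_sum] are [q ^ N] times a factor of modulus at most 2, and
    vanish in the limit. *)
Lemma PSeries_wcoef_0 (c q : R) (u : nat -> R) : trig_rec c u ->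
  (forall j, Rabs (u j) <= 1) -> Rabs q < 1 -> 0 < 1 - 2 * q * c + q * q ->
  PSeries (wcoef u 0) q
  = (q * u 1%nat - q * q * u 0%nat) / (1 - 2 * q * c + q * q).
Proof.
  intros Hr Hu Hq Hw; apply is_series_unique.
  set (w := 1 - _ + _) in *.
  change (is_lim_seq (sum_n (fun k => wcoef u 0 k * q ^ k))
    ((q * u 1%nat - q * q * u 0%nat) / w)).
  apply (is_lim_seq_ext (fun N =>
    (q * u 1%nat - q * q * u 0%nat) / w
    + (q ^ N * (- q * u (S N) + q * q * u N)) / w)).
  - intros N; rewrite sum_n_Reals; apply Rmult_eq_reg_l with w; [|lra].
    generalize (trig_rec_sum c q u N Hr); fold w; intros ->.
    simpl; field; lra.
  - replace (Finite ((q * u 1%nat - q * q * u 0%nat) / w))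
      with (Finite ((q * u 1%nat - q * q * u 0%nat) / w + 0))
      by (f_equal; apply Rplus_0_r).
    apply is_lim_seq_plus'; [apply is_lim_seq_const|].
    unfold Rdiv; rewrite <- (Rmult_0_l (/ w)).
    apply is_lim_seq_mult'; [|apply is_lim_seq_const].
    apply is_lim_seq_abs_0.
    apply (is_lim_seq_le_le (fun _ => 0) _ (fun N => Rabs q ^ N * 2)).
    + intros N; split; [apply Rabs_pos|].
      rewrite Rabs_mult, <- RPow_abs.
      apply Rmult_le_compat_l; [apply pow_le, Rabs_pos|].
      eapply Rle_trans; [apply Rabs_triang|].
      rewrite !Rabs_mult, Rabs_Ropp.
      generalize (Hu N) (Hu (S N)) (Rabs_pos (u N)) (Rabs_pos (u (S N)))
        (Rabs_pos q); intros; nra.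
    + apply is_lim_seq_const.
    + rewrite <- (Rmult_0_l 2).
      apply is_lim_seq_mult'; [|apply is_lim_seq_const].
      apply is_lim_seq_geom; now rewrite Rabs_Rabsolu.
Qed.

Lemma derive_eq_diff (f g d : R -> R) (a b : R) : a <= b ->
  (forall x, a < x < b -> is_derive f x (d x)) ->
  (forall x, a < x < b -> is_derive g x (d x)) ->
  (forall x, a <= x <= b -> continuity_pt f x) ->
  (forall x, a <= x <= b -> continuity_pt g x) ->
  f b - f a = g b - g a.
Proof.
  intros Hab Hf Hg Cf Cg.
  destruct (MVT_gen (fun x => f x - g x) a b (fun _ => 0)) as [c [_ Hc]].
  - rewrite Rmin_left, Rmax_right by lra; intros x Hx.
    replace 0 with (d x - d x) by ring.
    apply (is_derive_minus (V := R_NormedModule)); auto.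
  - rewrite Rmin_left, Rmax_right by lra; intros x Hx.
    apply (continuity_pt_minus f g); auto.
  - lra.
Qed.

Lemma Cauchy_MVT (f g f' g' : R -> R) (a b : R) : a < b ->
  (forall x, a < x < b -> is_derive f x (f' x)) ->
  (forall x, a < x < b -> is_derive g x (g' x)) ->
  (forall x, a <= x <= b -> continuity_pt f x) ->
  (forall x, a <= x <= b -> continuity_pt g x) ->
  exists c, a < c < b /\ (g b - g a) * f' c = (f b - f a) * g' c.
Proof.
  intros Hab Hf Hg Cf Cg.
  destruct (MVT f g a b
    (fun c Hc => exist _ (f' c) (proj1 (is_derive_Reals _ _ _) (Hf c Hc)))
    (fun c Hc => exist _ (g' c) (proj1 (is_derive_Reals _ _ _) (Hg c Hc)))
    Hab Cf Cg) as [c [Hc H]].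
  exists c; split; assumption.
Qed.

(** * The monotone rule of l'Hopital *)

(* [f / g] strictly decreases on (0, 1], with denominators cleared ([g > 0]). *)
Definition ratio_decr (f g : R -> R) : Prop :=
  forall x y, 0 < x -> x < y -> y <= 1 -> f y * g x < f x * g y.

Lemma pos_primitive (g b : R -> R) : g 0 = 0 ->
  (forall q, 0 <= q <= 1 -> continuity_pt g q) ->
  (forall q, 0 < q < 1 -> is_derive g q (b q / q)) ->
  (forall q, 0 < q <= 1 -> 0 < b q) ->
  forall x y, 0 <= x -> x < y -> y <= 1 -> g x < g y.
Proof.
  intros Hg0 Cg Hg Hb x y Hx Hxy Hy.
  destruct (Cauchy_MVT g (fun t => t) (fun q => b q / q) (fun _ => 1) x y Hxy)
    as [c [Hc H]].
  - intros q Hq; apply Hg; lra.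
  - intros q Hq; apply (is_derive_id (K := R_AbsRing)).
  - intros q Hq; apply Cg; lra.
  - intros q Hq; apply derivable_continuous_pt, derivable_pt_id.
  - assert (0 < b c / c) by (apply Rdiv_lt_0_compat; [apply Hb|]; lra); nra.
Qed.

(** Cauchy's mean value theorem on [[0, x]] and on [[x, y]] gives [c < x < d] such that [f x / g x]
    is [a / b] at [c] and the quotient of the increments is [a / b] at [d], hence smaller; the
    factors [1 / q] cancel. The last inequality is the case of [[0, 1]], where [c < 1]. *)
Lemma monotone_LHopital (f g a b : R -> R) : f 0 = 0 -> g 0 = 0 ->
  (forall q, 0 <= q <= 1 -> continuity_pt f q) ->
  (forall q, 0 <= q <= 1 -> continuity_pt g q) ->
  (forall q, 0 < q < 1 -> is_derive f q (a q / q)) ->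
  (forall q, 0 < q < 1 -> is_derive g q (b q / q)) ->
  (forall q, 0 < q <= 1 -> 0 < b q) -> ratio_decr a b ->
  (forall q, 0 < q <= 1 -> 0 < g q) /\ ratio_decr f g /\
  a 1 * g 1 < f 1 * b 1.
Proof.
  intros Hf0 Hg0 Cf Cg Hf Hg Hb Hab.
  assert (Hinc := pos_primitive g b Hg0 Cg Hg Hb).
  assert (Hpos : forall q, 0 < q <= 1 -> 0 < g q).
  { intros q Hq; rewrite <- Hg0; apply Hinc; lra. }
  assert (HC : forall x y, 0 <= x -> x < y -> y <= 1 ->
    exists c, x < c < y /\ (g y - g x) * a c = (f y - f x) * b c).
  { intros x y Hx Hxy Hy.
    destruct (Cauchy_MVT f g (fun q => a q / q) (fun q => b q / q) x y Hxy)
      as [c [Hc H]].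
    - intros q Hq; apply Hf; lra.
    - intros q Hq; apply Hg; lra.
    - intros q Hq; apply Cf; lra.
    - intros q Hq; apply Cg; lra.
    - exists c; split; trivial.
      apply Rmult_eq_reg_r with (/ c); [unfold Rdiv in H; lra|].
      apply Rinv_neq_0_compat; lra. }
  split; [exact Hpos|split].
  - intros x y Hx Hxy Hy.
    destruct (HC 0 x) as [c [Hc H1]]; try lra.
    destruct (HC x y) as [d [Hd H2]]; try lra.
    rewrite Hf0, Hg0, !Rminus_0_r in H1.
    assert (Hcd := Hab c d ltac:(lra) ltac:(lra) ltac:(lra)).
    assert (Hgx := Hpos x ltac:(lra)).
    assert (Hgxy := Hinc x y ltac:(lra) ltac:(lra) ltac:(lra)).
    assert (Hbc := Hb c ltac:(lra)); assert (Hbd := Hb d ltac:(lra)).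
    assert (Ef : f x = g x * a c / b c) by (rewrite H1; field; lra).
    assert (Ed : f y - f x = (g y - g x) * a d / b d)
      by (rewrite H2; field; lra).
    assert (Hr : a d / b d < a c / b c).
    { apply Rmult_lt_reg_r with (b c * b d); [nra|].
      replace (a d / b d * (b c * b d)) with (a d * b c) by (field; lra).
      replace (a c / b c * (b c * b d)) with (a c * b d) by (field; lra).
      exact Hcd. }
    apply Rminus_lt_0.
    replace (f x * g y - f y * g x)
      with (f x * (g y - g x) - (f y - f x) * g x) by ring.
    rewrite Ed, Ef.
    replace (_ - _) with (g x * (g y - g x) * (a c / b c - a d / b d))
      by (field; lra).
    repeat apply Rmult_lt_0_compat; lra.
  - destruct (HC 0 1) as [c [Hc H1]]; try lra.
    rewrite Hf0, Hg0, !Rminus_0_r in H1.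
    assert (Hc1 := Hab c 1 ltac:(lra) ltac:(lra) ltac:(lra)).
    assert (Hbc := Hb c ltac:(lra)); assert (Hg1 := Hpos 1 ltac:(lra)).
    apply Rmult_lt_reg_r with (b c); [lra|].
    replace (f 1 * b 1 * b c) with (f 1 * b c * b 1) by ring.
    rewrite <- H1; nra.
Qed.

(** * Abel sums at q = 1 *)

(* Truncation to [0, 1], which makes [polylog] continuous on both sides of [1]. *)
Definition clamp (q : R) : R := (1 + Rabs q - Rabs (q - 1)) / 2.

Lemma clamp_id (q : R) : 0 <= q <= 1 -> clamp q = q.
Proof.
  intros Hq; unfold clamp; rewrite (Rabs_pos_eq q), (Rabs_left1 (q - 1)); lra.
Qed.

Lemma clamp_bound (q : R) : 0 <= clamp q <= 1.
Proof.
  unfold clamp; unfold Rabs; destruct (Rcase_abs q), (Rcase_abs (q - 1)); lra.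
Qed.

Lemma clamp_continuity : continuity clamp.
Proof.
  intros q; unfold clamp, Rdiv.
  apply (continuity_pt_mult (fun q => 1 + Rabs q - Rabs (q - 1)) (fun _ => / 2)).
  - apply (continuity_pt_minus (fun q => 1 + Rabs q) (fun q => Rabs (q - 1))).
    + apply (continuity_pt_plus (fun _ => 1) Rabs); [|apply Rcontinuity_abs].
      apply continuity_pt_const; intros ? ?; reflexivity.
    + apply (continuity_pt_comp (fun q => q - 1) Rabs); [|apply Rcontinuity_abs].
      apply (continuity_pt_minus (fun q => q) (fun _ => 1)).
      * apply derivable_continuous_pt, derivable_pt_id.
      * apply continuity_pt_const; intros ? ?; reflexivity.
  - apply continuity_pt_const; intros ? ?; reflexivity.
Qed.

Definition polylog (u : nat -> R) (n : nat) (q : R) : R :=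
  PSeries (wcoef u n) (clamp q).

(* Continuity at [1] makes [f 1] the Abel sum of the series, which for [n <= 1]
   need not converge absolutely. *)
Definition Abel_sum (u : nat -> R) (n : nat) (f : R -> R) : Prop :=
  (forall q, 0 <= q < 1 -> f q = PSeries (wcoef u n) q) /\
  (forall q, 0 <= q <= 1 -> continuity_pt f q).

(** Since [clamp] takes values in [[0, 1]], the terms are dominated by [1 / k^2] on the whole
    line. *)
Lemma polylog_Abel_sum (u : nat -> R) (n : nat) :
  (forall j, Rabs (u j) <= 1) -> (2 <= n)%nat -> Abel_sum u n (polylog u n).
Proof.
  intros Hu Hn; split; intros q Hq.
  - unfold polylog; now rewrite clamp_id by lra.
  - unfold polylog, PSeries.
    apply continuity_Series with (wcoef (fun _ => 1) 2).
    + exact ex_series_inv_sqr.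
    + intros k y; rewrite Rabs_mult; destruct (clamp_bound y) as [H0 H1].
      rewrite (Rabs_pos_eq (_ ^ k)) by now apply pow_le.
      rewrite <- (Rmult_1_r (wcoef _ 2 k)).
      apply Rmult_le_compat; [apply Rabs_pos|now apply pow_le| |].
      * now apply Rabs_wcoef_2.
      * rewrite <- (pow1 k); now apply pow_incr.
    + intros k y.
      apply (continuity_pt_mult (fun _ => wcoef u n k) (fun y => clamp y ^ k)).
      * apply continuity_pt_const; intros ? ?; reflexivity.
      * apply (continuity_pt_comp clamp (fun t => t ^ k)).
        -- apply clamp_continuity.
        -- apply derivable_continuous_pt, derivable_pt_pow.
Qed.

Lemma polylog_1 (u : nat -> R) (n : nat) : polylog u n 1 = Series (wcoef u n).
Proof. unfold polylog; rewrite clamp_id by lra; apply PSeries_1. Qed.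

Lemma Abel_sum_derive (u : nat -> R) (n : nat) (f g : R -> R) (q : R) :
  (forall j, Rabs (u j) <= 1) -> Abel_sum u (S n) f ->
  (forall t, 0 < t < 1 -> g t = PSeries (wcoef u n) t) -> 0 < q < 1 ->
  is_derive f q (g q / q).
Proof.
  intros Hu [Hf _] Hg Hq; rewrite Hg by trivial.
  apply (is_derive_ext_loc (PSeries (wcoef u (S n)))).
  - assert (He : 0 < Rmin q (1 - q)) by (apply Rmin_pos; lra).
    exists (mkposreal _ He); intros t Ht; symmetry; apply Hf.
    apply Rabs_def2 in Ht; simpl in Ht; unfold minus, plus, opp in Ht; simpl in Ht.
    generalize (Rmin_l q (1 - q)) (Rmin_r q (1 - q)); lra.
  - now apply PSeries_wcoef_derive.
Qed.

Lemma Abel_sum_0 (u : nat -> R) (n : nat) (f : R -> R) :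
  Abel_sum u n f -> f 0 = 0.
Proof.
  intros [Hf _]; rewrite Hf by lra; now rewrite PSeries_0.
Qed.

(** The value at 0 and the derivative identify [f] with the power series. This serves for the closed
    forms at index 1. *)
Lemma Abel_sum_intro (u : nat -> R) (n : nat) (f : R -> R) :
  (forall j, Rabs (u j) <= 1) -> f 0 = 0 ->
  (forall q, 0 <= q <= 1 -> continuity_pt f q) ->
  (forall q, 0 < q < 1 -> is_derive f q (PSeries (wcoef u n) q / q)) ->
  Abel_sum u (S n) f.
Proof.
  intros Hu Hf0 Cf Hf; split; trivial; intros q Hq.
  assert (H : f q - f 0
    = PSeries (wcoef u (S n)) q - PSeries (wcoef u (S n)) 0).
  { apply derive_eq_diff with (fun t => PSeries (wcoef u n) t / t); [lra| | | |].
    - intros t Ht; apply Hf; lra.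
    - intros t Ht; apply PSeries_wcoef_derive; trivial; lra.
    - intros t Ht; apply Cf; lra.
    - intros t Ht; apply PSeries_continuity, CV_radius_wcoef; trivial.
      rewrite Rabs_pos_eq; lra. }
  rewrite PSeries_0 in H; simpl in H; lra.
Qed.

(** * Cosine and sine sums with parameter [q] *)

Definition cosseq (x : R) (k : nat) : R := cos (INR k * x).
Definition sinseq (x : R) (k : nat) : R := sin (INR k * x).

Lemma cosseq_bound (x : R) (k : nat) : Rabs (cosseq x k) <= 1.
Proof. apply Rabs_le, COS_bound. Qed.

Lemma sinseq_bound (x : R) (k : nat) : Rabs (sinseq x k) <= 1.
Proof. apply Rabs_le, SIN_bound. Qed.

Lemma cosseq_rec (x : R) : trig_rec (cos x) (cosseq x).
Proof.
  intros k; unfold cosseq.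
  replace (INR (S (S k)) * x) with (INR (S k) * x + x)
    by (rewrite (S_INR (S k)); ring).
  replace (INR k * x) with (INR (S k) * x - x) by (rewrite S_INR; ring).
  rewrite cos_plus, cos_minus; ring.
Qed.

Lemma sinseq_rec (x : R) : trig_rec (cos x) (sinseq x).
Proof.
  intros k; unfold sinseq.
  replace (INR (S (S k)) * x) with (INR (S k) * x + x)
    by (rewrite (S_INR (S k)); ring).
  replace (INR k * x) with (INR (S k) * x - x) by (rewrite S_INR; ring).
  rewrite sin_plus, sin_minus; ring.
Qed.

(* The squared modulus of [1 - q e^(i x)]. *)
Definition pois (x q : R) : R := 1 - 2 * q * cos x + q * q.

(* At [n <= 1] the closed forms give the value at [q = 1]. *)
Definition Csum (x : R) (n : nat) : R -> R :=
  match n with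
  | 1%nat => fun q => - ln (pois x q) / 2
  | _ => polylog (cosseq x) n
  end.

Definition Ssum (x : R) (n : nat) : R -> R :=
  match n with
  | 0%nat => fun q => q * sin x / pois x q
  | 1%nat => fun q => atan (q * sin x / (1 - q * cos x))
  | _ => polylog (sinseq x) n
  end.

Lemma cos_sin_open (x : R) : 0 < x < PI ->
  0 < sin x /\ -1 < cos x < 1 /\ sin x * sin x + cos x * cos x = 1.
Proof.
  intros Hx; assert (Hs : 0 < sin x) by (apply sin_gt_0; lra).
  assert (H := sin2_cos2 x); unfold Rsqr in H; repeat split; nra.
Qed.

(** Completing the square: [pois x q] is [(q - cos x)^2 + (sin x)^2]. *)
Lemma pois_pos (x q : R) : 0 < x < PI -> 0 < pois x q.
Proof.
  intros Hx; destruct (cos_sin_open x Hx) as [Hs [Hc H]]; unfold pois.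
  assert (0 <= (q - cos x) * (q - cos x)) by apply Rle_0_sqr; nra.
Qed.

Lemma PSeries_cosseq_0 (x q : R) : 0 < x < PI -> 0 <= q < 1 ->
  PSeries (wcoef (cosseq x) 0) q = (q * cos x - q * q) / pois x q.
Proof.
  intros Hx Hq; rewrite (PSeries_wcoef_0 (cos x)).
  - unfold cosseq; simpl; rewrite Rmult_0_l, cos_0, Rmult_1_l, Rmult_1_r.
    reflexivity.
  - apply cosseq_rec.
  - apply cosseq_bound.
  - rewrite Rabs_pos_eq; lra.
  - now apply pois_pos.
Qed.

Lemma PSeries_sinseq_0 (x q : R) : 0 < x < PI -> 0 <= q < 1 ->
  PSeries (wcoef (sinseq x) 0) q = q * sin x / pois x q.
Proof.
  intros Hx Hq; rewrite (PSeries_wcoef_0 (cos x)).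
  - unfold sinseq; simpl; rewrite Rmult_0_l, sin_0, Rmult_1_l, Rmult_0_r, Rminus_0_r.
    reflexivity.
  - apply sinseq_rec.
  - apply sinseq_bound.
  - rewrite Rabs_pos_eq; lra.
  - now apply pois_pos.
Qed.

Lemma ex_derive_continuity_pt (f : R -> R) (x : R) :
  ex_derive f x -> continuity_pt f x.
Proof.
  intros H; apply continuity_pt_filterlim.
  exact (ex_derive_continuous (V := R_NormedModule) f x H).
Qed.

(** At index 1 the closed form is the real part of [- ln (1 - q e^(i x))], checked through its
    derivative [(cos x - q) / pois x q]. *)
Lemma Csum_Abel_sum (x : R) (n : nat) : 0 < x < PI -> (1 <= n)%nat ->
  Abel_sum (cosseq x) n (Csum x n).
Proof.
  intros Hx Hn.
  destruct n as [|[|n]]; [lia| |apply polylog_Abel_sum; [apply cosseq_bound|lia]].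
  assert (Hd : forall q,
    is_derive (Csum x 1) q (- ((- 2 * cos x + 2 * q) / pois x q) / 2)).
  { intros q; assert (Hw := pois_pos x q Hx).
    unfold Csum, pois in *; auto_derive; [lra|field; lra]. }
  apply Abel_sum_intro.
  - apply cosseq_bound.
  - unfold Csum, pois; replace (_ + _) with 1 by ring; rewrite ln_1; lra.
  - intros q _; apply ex_derive_continuity_pt; eexists; apply Hd.
  - intros q Hq; rewrite PSeries_cosseq_0 by lra.
    replace (_ / q) with (- ((- 2 * cos x + 2 * q) / pois x q) / 2).
    + apply Hd.
    + assert (Hw := pois_pos x q Hx); field; lra.
Qed.

Lemma Ssum_Abel_sum (x : R) (n : nat) : 0 < x < PI ->
  Abel_sum (sinseq x) n (Ssum x n).
Proof.
  intros Hx; destruct (cos_sin_open x Hx) as [Hs [Hc H]].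
  destruct n as [|[|n]]; [| |apply polylog_Abel_sum; [apply sinseq_bound|lia]].
  - split; intros q Hq.
    + rewrite PSeries_sinseq_0; trivial.
    + apply ex_derive_continuity_pt.
      assert (Hw := pois_pos x q Hx).
      unfold Ssum, pois in *; auto_derive; lra.
  (* The real part of [1 - q e^(i x)] stays positive, so the argument is given by [atan] without a
     jump up to [q = 1]. *)
  - assert (H1 : forall q, 0 <= q <= 1 -> 0 < 1 - q * cos x) by (intros; nra).
    assert (Hd : forall q, 0 <= q <= 1 ->
      is_derive (Ssum x 1) q (sin x / pois x q)).
    { intros q Hq; assert (Hw := pois_pos x q Hx); specialize (H1 q Hq).
      unfold Ssum, pois in *; auto_derive; [lra|].
      assert (E : (1 - q * cos x) * (1 - q * cos x) + q * sin x * (q * sin x)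
        = 1 - 2 * q * cos x + q * q) by nra.
      rewrite <- E in *; unfold Rsqr; field; split; [|lra].
      intros H2; apply (Rlt_irrefl 0); rewrite <- H2 at 2; nra. }
    apply Abel_sum_intro.
    + apply sinseq_bound.
    + unfold Ssum; rewrite Rmult_0_l; unfold Rdiv; rewrite Rmult_0_l.
      apply atan_0.
    + intros q Hq; apply ex_derive_continuity_pt; eexists; apply Hd, Hq.
    + intros q Hq; rewrite PSeries_sinseq_0 by lra.
      replace (_ / q) with (sin x / pois x q).
      * apply Hd; lra.
      * assert (Hw := pois_pos x q Hx); field; lra.
Qed.

Lemma ln_le_minus_1 (w : R) : 0 < w -> ln w <= w - 1.
Proof.
  intros Hw; generalize (exp_ineq1_le (ln w)); rewrite exp_ln by trivial; lra.
Qed.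

Lemma ratio_decr_base (x : R) : 0 < x < PI ->
  ratio_decr (Csum x 1) (Ssum x 0) /\ (forall q, 0 < q <= 1 -> 0 < Ssum x 0 q).
Proof.
  intros Hx; destruct (cos_sin_open x Hx) as [Hs [Hc H]]; split.
  2:{ intros q Hq; assert (Hw := pois_pos x q Hx); unfold Ssum.
      apply Rdiv_lt_0_compat; nra. }
  (* The quotient of [Csum x 1] by [Ssum x 0] is [- phi / (2 * sin x)], so [phi] has to increase. *)
  set (phi := fun q => pois x q * ln (pois x q) / q).
  assert (Hphi : forall a b, 0 < a -> a < b -> b <= 1 -> phi a < phi b).
  { intros a b Ha Hab Hb.
    destruct (MVT_cor2 phi (fun q =>
      ((q * q - 1) * ln (pois x q) + pois x q - 1 + q * q) / (q * q)) a b Hab)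
      as [c [Hc1 Hc2]].
    - intros q Hq; apply is_derive_Reals; assert (Hw := pois_pos x q Hx).
      unfold phi, pois in *; auto_derive; [lra|].
      change (1 + - (2 * q * cos x) + q * q)
        with (1 - 2 * q * cos x + q * q).
      field; lra.
    - apply Rminus_lt_0; rewrite Hc1; apply Rmult_lt_0_compat; [|lra].
      apply Rdiv_lt_0_compat; [|nra].
      (* As [c * c - 1 < 0], the inequality [ln w <= w - 1] bounds the numerator below by
         [c * c * pois x c]. *)
      assert (Hw := pois_pos x c Hx); assert (Hl := ln_le_minus_1 _ Hw).
      assert (0 < c * c * pois x c) by (apply Rmult_lt_0_compat; nra).
      assert (0 < 1 - c * c) by nra; nra. }
  intros a b Ha Hab Hb; specialize (Hphi a b Ha Hab Hb).
  unfold Csum, Ssum, phi in *.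
  assert (Hwa := pois_pos x a Hx); assert (Hwb := pois_pos x b Hx).
  set (u := pois x a) in *; set (v := pois x b) in *.
  apply Rminus_lt_0.
  replace (_ - _) with
    ((v * ln v / b - u * ln u / a) * (a * b * sin x / (2 * u * v)))
    by (field; lra).
  apply Rmult_lt_0_compat; [lra|].
  apply Rdiv_lt_0_compat; repeat apply Rmult_lt_0_compat; lra.
Qed.

Lemma Csum_Ssum_LHopital (x : R) (n : nat) : 0 < x < PI ->
  ratio_decr (Csum x (S n)) (Ssum x n) ->
  (forall q, 0 < q <= 1 -> 0 < Ssum x n q) ->
  (forall q, 0 < q <= 1 -> 0 < Ssum x (S n) q) /\
  ratio_decr (Csum x (S (S n))) (Ssum x (S n)) /\
  Csum x (S n) 1 * Ssum x (S n) 1 < Csum x (S (S n)) 1 * Ssum x n 1.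
Proof.
  intros Hx Hr Hp.
  assert (A1 := Csum_Abel_sum x (S (S n)) Hx ltac:(lia)).
  assert (A0 := Csum_Abel_sum x (S n) Hx ltac:(lia)).
  assert (B1 := Ssum_Abel_sum x (S n) Hx).
  assert (B0 := Ssum_Abel_sum x n Hx).
  apply monotone_LHopital; trivial.
  - exact (Abel_sum_0 _ _ _ A1).
  - exact (Abel_sum_0 _ _ _ B1).
  - apply A1.
  - apply B1.
  - intros q Hq; apply (Abel_sum_derive (cosseq x) (S n)); trivial.
    + apply cosseq_bound.
    + intros t Ht; apply A0; lra.
  - intros q Hq; apply (Abel_sum_derive (sinseq x) n); trivial.
    + apply sinseq_bound.
    + intros t Ht; apply B0; lra.
Qed.

Lemma Csum_Ssum_ratio_decr (x : R) (n : nat) : 0 < x < PI ->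
  ratio_decr (Csum x (S n)) (Ssum x n) /\
  (forall q, 0 < q <= 1 -> 0 < Ssum x n q).
Proof.
  intros Hx; induction n as [|n [IH1 IH2]]; [now apply ratio_decr_base|].
  now destruct (Csum_Ssum_LHopital x n Hx IH1 IH2) as [H1 [H2 _]].
Qed.

Lemma Ssum_pos (x : R) (n : nat) : 0 < x < PI -> 0 < Ssum x n 1.
Proof. intros Hx; apply Csum_Ssum_ratio_decr; trivial; lra. Qed.

Lemma Csum_Ssum_step (x : R) (n : nat) : 0 < x < PI ->
  Csum x (S n) 1 / Ssum x n 1 < Csum x (S (S n)) 1 / Ssum x (S n) 1.
Proof.
  intros Hx; destruct (Csum_Ssum_ratio_decr x n Hx) as [H1 H2].
  destruct (Csum_Ssum_LHopital x n Hx H1 H2) as [_ [_ H]].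
  assert (P0 := Ssum_pos x n Hx); assert (P1 := Ssum_pos x (S n) Hx).
  apply Rmult_lt_reg_r with (Ssum x n 1 * Ssum x (S n) 1); [nra|].
  replace (Csum x (S n) 1 / _ * _) with (Csum x (S n) 1 * Ssum x (S n) 1)
    by (field; lra).
  replace (Csum x (S (S n)) 1 / _ * _) with (Csum x (S (S n)) 1 * Ssum x n 1)
    by (field; lra).
  exact H.
Qed.

(** The half-angle identity [sin x / (1 - cos x) = cot (x / 2) = tan ((PI - x) / 2)]. It brings
    [bern B 1] under the same formula as the higher odd indices. *)
Lemma Ssum_1_1 (x : R) : 0 < x < PI -> Ssum x 1 1 = (PI - x) / 2.
Proof.
  intros Hx; unfold Ssum; rewrite !Rmult_1_l.
  rewrite <- (atan_tan ((PI - x) / 2)) by lra; f_equal.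
  assert (Hs : 0 < sin (x / 2)) by (apply sin_gt_0; lra).
  unfold tan; replace ((PI - x) / 2) with (PI / 2 - x / 2) by field.
  rewrite sin_shift, cos_shift.
  replace x with (2 * (x / 2)) at 1 2 by field.
  rewrite sin_2a, cos_2a_sin; field; split; nra.
Qed.

Lemma Csum_1 (x : R) (n : nat) : (2 <= n)%nat ->
  Csum x n 1 = Series (wcoef (cosseq x) n).
Proof. intros Hn; destruct n as [|[|n]]; [lia|lia|apply polylog_1]. Qed.

Lemma Ssum_1 (x : R) (n : nat) : (2 <= n)%nat ->
  Ssum x n 1 = Series (wcoef (sinseq x) n).
Proof. intros Hn; destruct n as [|[|n]]; [lia|lia|apply polylog_1]. Qed.

(** * Fourier expansion of the Bernoulli polynomials *)

Lemma sin_INR_PI (k : nat) : sin (INR k * PI) = 0.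
Proof. apply sin_eq_0_1; exists (Z.of_nat k); now rewrite INR_IZR_INZ. Qed.

Lemma Dirichlet_kernel (x : R) (N : nat) :
  2 * sin (x / 2) * (1 / 2 + sum_f_R0 (wcoef (cosseq x) 0) N)
  = sin ((INR N + 1 / 2) * x).
Proof.
  induction N as [|N IH].
  - simpl; replace ((0 + 1 / 2) * x) with (x / 2) by field; field.
  - rewrite tech5, <- Rplus_assoc, Rmult_plus_distr_l, IH.
    unfold wcoef, cosseq; rewrite pow_O, Rdiv_1_r.
    replace ((INR N + 1 / 2) * x) with (INR (S N) * x - x / 2)
      by (rewrite S_INR; field).
    replace ((INR (S N) + 1 / 2) * x) with (INR (S N) * x + x / 2) by field.
    rewrite sin_plus, sin_minus; ring.
Qed.

Lemma wcoef_sinseq_derive (n k : nat) (x : R) :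
  is_derive (fun y => wcoef (sinseq y) (S n) k) x (wcoef (cosseq x) n k).
Proof.
  destruct k as [|k]; unfold wcoef.
  - exact (is_derive_const (K := R_AbsRing) (V := R_NormedModule) 0 x).
  - assert (H := INR_S_ge_1 k); revert H.
    unfold sinseq, cosseq; generalize (INR (S k)); intros a Ha.
    assert (Hp : a ^ n <> 0) by (apply pow_nonzero; lra).
    rewrite <- tech_pow_Rmult; auto_derive; [trivial|field; lra].
Qed.

Lemma wcoef_cosseq_derive (n k : nat) (x : R) :
  is_derive (fun y => wcoef (cosseq y) (S n) k) x (- wcoef (sinseq x) n k).
Proof.
  destruct k as [|k]; unfold wcoef.
  - rewrite Ropp_0.
    exact (is_derive_const (K := R_AbsRing) (V := R_NormedModule) 0 x).
  - assert (H := INR_S_ge_1 k); revert H.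
    unfold sinseq, cosseq; generalize (INR (S k)); intros a Ha.
    assert (Hp : a ^ n <> 0) by (apply pow_nonzero; lra).
    rewrite <- tech_pow_Rmult; auto_derive; [trivial|field; lra].
Qed.

(* The last term is the leading part of the error in the convergence of the
   sine series to the sawtooth: adding it makes the derivative O(1/N). *)
Definition sawtooth_defect (N : nat) (x : R) : R :=
  sum_f_R0 (fun k => wcoef (sinseq x) 1 k) N - (PI - x) / 2
  + cos ((INR N + 1 / 2) * x) / ((2 * INR N + 1) * sin (x / 2)).

(** By [Dirichlet_kernel] the sum and the sawtooth contribute [sin ((N + 1/2) x) / (2 sin (x / 2))].
    The derivative of the cosine in the correction cancels it exactly, and only the derivative of
    [1 / sin (x / 2)] survives. *)
Lemma sawtooth_defect_derive (N : nat) (x : R) : 0 < sin (x / 2) ->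
  is_derive (sawtooth_defect N) x
    (- (cos ((INR N + 1 / 2) * x) * cos (x / 2)
        / (2 * (2 * INR N + 1) * (sin (x / 2) * sin (x / 2))))).
Proof.
  intros Hs; assert (HN := pos_INR N); assert (HD := Dirichlet_kernel x N).
  set (D := sum_f_R0 (wcoef (cosseq x) 0) N) in *.
  replace (- _) with ((D - (- 1 / 2))
    + (- (sin ((INR N + 1 / 2) * x) / (2 * sin (x / 2)))
    - (cos ((INR N + 1 / 2) * x) * cos (x / 2)
        / (2 * (2 * INR N + 1) * (sin (x / 2) * sin (x / 2))))))
    by (rewrite <- HD; field; lra).
  unfold sawtooth_defect.
  apply (is_derive_plus (V := R_NormedModule)
    (fun x => sum_f_R0 (fun k => wcoef (sinseq x) 1 k) N - (PI - x) / 2)).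
  - apply (is_derive_minus (V := R_NormedModule)).
    + apply (sum_f_R0_derive (fun k x => wcoef (sinseq x) 1 k)
        (fun k x => wcoef (cosseq x) 0 k)).
      intros k; apply wcoef_sinseq_derive.
    + auto_derive; [trivial|field].
  - auto_derive.
    + apply Rmult_integral_contrapositive_currified; [lra|].
      change (x * / 2) with (x / 2); lra.
    + change (x * / 2) with (x / 2); field; lra.
Qed.

Lemma sawtooth_defect_PI (N : nat) : sawtooth_defect N PI = 0.
Proof.
  unfold sawtooth_defect.
  replace ((INR N + 1 / 2) * PI) with (INR N * PI + PI / 2) by field.
  rewrite cos_plus, cos_PI2, sin_INR_PI.
  rewrite (sum_eq_R0 _ N).
  - unfold Rdiv; ring.
  - intros [|k] _; unfold wcoef, sinseq; trivial.
    rewrite sin_INR_PI; unfold Rdiv; ring.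
Qed.

Lemma sin_half_ge (d y : R) : 0 < d <= PI -> d <= y <= 2 * PI - d ->
  sin (d / 2) <= sin (y / 2).
Proof.
  intros Hd Hy; destruct (Rle_lt_dec y PI) as [H|H].
  - apply sin_incr_1; lra.
  - rewrite <- (sin_PI_x (y / 2)); apply sin_incr_1; lra.
Qed.

(** The first summand of the constant bounds the defect, by the mean value theorem from [PI], where
    it vanishes; the second bounds the correction term. Uniformity away from 0 and [2 * PI] is what
    termwise differentiation needs. *)
Lemma sawtooth_bound (d x : R) (N : nat) : 0 < d <= PI ->
  d <= x <= 2 * PI - d ->
  Rabs (sum_f_R0 (fun k => wcoef (sinseq x) 1 k) N - (PI - x) / 2)
  <= (PI / (sin (d / 2) * sin (d / 2)) + / sin (d / 2)) / (2 * INR N + 1).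
Proof.
  intros Hd Hx; assert (Hm : 0 < sin (d / 2)) by (apply sin_gt_0; lra).
  assert (HN := pos_INR N).
  assert (Hge : forall y, d <= y <= 2 * PI - d -> sin (d / 2) <= sin (y / 2))
    by (intros; now apply sin_half_ge).
  set (m := sin (d / 2)) in *; set (n := 2 * INR N + 1) in *.
  assert (Hn : 0 < n) by (unfold n; lra).
  replace (_ - _) with (sawtooth_defect N x
    - cos ((INR N + 1 / 2) * x) / (n * sin (x / 2)))
    by (unfold sawtooth_defect; fold n; ring).
  replace (_ / n) with (PI / (m * m * n) + / (m * n)) by (field; lra).
  unfold Rminus; eapply Rle_trans; [apply Rabs_triang|].
  rewrite Rabs_Ropp; apply Rplus_le_compat.
  - destruct (MVT_gen (sawtooth_defect N) PI x (fun x =>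
      - (cos ((INR N + 1 / 2) * x) * cos (x / 2)
        / (2 * n * (sin (x / 2) * sin (x / 2)))))) as [c [Hc H]].
    + intros y Hy; apply sawtooth_defect_derive.
      apply Rlt_le_trans with m; trivial; apply Hge; revert Hy.
      unfold Rmin, Rmax; destruct Rle_dec; lra.
    + intros y Hy; apply ex_derive_continuity_pt; eexists.
      apply sawtooth_defect_derive.
      apply Rlt_le_trans with m; trivial; apply Hge; revert Hy.
      unfold Rmin, Rmax; destruct Rle_dec; lra.
    + rewrite sawtooth_defect_PI, Rminus_0_r in H; rewrite H.
      assert (Hcm : m <= sin (c / 2)).
      { apply Hge; revert Hc; unfold Rmin, Rmax; destruct Rle_dec; lra. }
      set (t := sin (c / 2)) in *.
      replace (PI / (m * m * n)) with (/ (m * m * n) * PI) by (field; lra).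
      rewrite Rabs_mult, Rabs_Ropp.
      apply Rmult_le_compat; try apply Rabs_pos; [|apply Rabs_le; lra].
      assert (Ht : m * m * n <= 2 * n * (t * t)).
      { assert (Hmt : m * m <= t * t) by (apply Rmult_le_compat; lra).
        assert (0 <= m * m) by nra; nra. }
      assert (0 < m * m * n) by (repeat apply Rmult_lt_0_compat; lra).
      unfold Rdiv; rewrite Rabs_mult, Rabs_inv, (Rabs_pos_eq (2 * _ * _)) by lra.
      rewrite <- (Rmult_1_l (/ (m * m * n))).
      apply Rmult_le_compat; [apply Rabs_pos| | |].
      * left; apply Rinv_0_lt_compat; lra.
      * rewrite Rabs_mult, <- (Rmult_1_r 1).
        apply Rmult_le_compat; try apply Rabs_pos; apply Rabs_le, COS_bound.
      * apply Rinv_le_contravar; lra.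
  - specialize (Hge x Hx); set (t := sin (x / 2)) in *.
    assert (Ht : m * n <= n * t) by nra.
    assert (0 < m * n) by (apply Rmult_lt_0_compat; lra).
    unfold Rdiv; rewrite Rabs_mult, Rabs_inv, (Rabs_pos_eq (n * t)) by lra.
    rewrite <- (Rmult_1_l (/ (m * n))).
    apply Rmult_le_compat; [apply Rabs_pos| | |].
    + left; apply Rinv_0_lt_compat; lra.
    + apply Rabs_le, COS_bound.
    + apply Rinv_le_contravar; lra.
Qed.

Lemma sum_f_R0_opp (a : nat -> R) (N : nat) :
  sum_f_R0 (fun k => - a k) N = - sum_f_R0 a N.
Proof. induction N as [|N IH]; simpl; [|rewrite IH]; ring. Qed.

(** The differentiated series has coefficients of order [1 / k], out of reach of the M-test;
    [sawtooth_bound] supplies local uniform convergence instead. *)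
Lemma cos_series_2_derive (x : R) : 0 < x < 2 * PI ->
  is_derive (fun y => Series (wcoef (cosseq y) 2)) x (- ((PI - x) / 2)).
Proof.
  intros Hx; assert (He : 0 < Rmin x (2 * PI - x) / 2).
  { assert (0 < Rmin x (2 * PI - x)) by (apply Rmin_pos; lra); lra. }
  (* Half the distance to the endpoints, so that the ball of radius [d] around [x] keeps a distance
     [d] from them. *)
  set (d := Rmin x (2 * PI - x) / 2) in *.
  assert (Hd1 : 2 * d <= x) by (generalize (Rmin_l x (2 * PI - x)); unfold d; lra).
  assert (Hd2 : 2 * d <= 2 * PI - x)
    by (generalize (Rmin_r x (2 * PI - x)); unfold d; lra).
  apply is_derive_Reals.
  apply (CVU_derivable
    (fun N y => sum_f_R0 (fun k => wcoef (cosseq y) 2 k) N)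
    (fun N y => sum_f_R0 (fun k => - wcoef (sinseq y) 1 k) N) _
    (fun y => - ((PI - y) / 2)) x (mkposreal d He)).
  - intros eps Heps.
    set (K := PI / (sin (d / 2) * sin (d / 2)) + / sin (d / 2)).
    destruct (INR_unbounded (K / eps)) as [N HN].
    exists N; intros n y Hn Hy.
    assert (Hyd : d <= y <= 2 * PI - d).
    { unfold Boule in Hy; simpl in Hy; apply Rabs_def2 in Hy; lra. }
    rewrite (sum_f_R0_opp (fun k => wcoef (sinseq y) 1 k)).
    apply Rle_lt_trans with
      (Rabs (sum_f_R0 (fun k => wcoef (sinseq y) 1 k) n - (PI - y) / 2));
      [right; f_equal; ring|].
    eapply Rle_lt_trans; [apply (sawtooth_bound d); lra|fold K].
    apply le_INR in Hn; assert (H0 := pos_INR N).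
    apply Rmult_lt_reg_r with (2 * INR n + 1); [lra|].
    unfold Rdiv; rewrite Rmult_assoc, Rinv_l, Rmult_1_r by lra.
    apply Rmult_lt_compat_r with (r := eps) in HN; trivial.
    unfold Rdiv in HN; rewrite Rmult_assoc, Rinv_l, Rmult_1_r in HN by lra.
    nra.
  - intros y _; apply ex_series_Un_cv, ex_series_wcoef; [apply cosseq_bound|lia].
  - intros N y _; apply is_derive_Reals.
    apply (sum_f_R0_derive (fun k y => wcoef (cosseq y) 2 k)
      (fun k y => - wcoef (sinseq y) 1 k)).
    intros k; apply wcoef_cosseq_derive.
  - apply Boule_center.
Qed.

Lemma cos_series_derive (n : nat) (x : R) : (2 <= n)%nat ->
  is_derive (fun y => Series (wcoef (cosseq y) (S n))) x
    (- Series (wcoef (sinseq x) n)).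
Proof.
  intros Hn; rewrite <- Series_opp.
  apply (is_derive_Series (fun k y => wcoef (cosseq y) (S n) k)
    (fun k y => - wcoef (sinseq y) n k) (wcoef (fun _ => 1) 2)).
  - exact ex_series_inv_sqr.
  - intros k y; rewrite Rabs_Ropp; apply Rabs_wcoef_2; trivial.
    apply sinseq_bound.
  - intros y; apply ex_series_wcoef; [apply cosseq_bound|lia].
  - intros k y; apply wcoef_cosseq_derive.
Qed.

Lemma sin_series_derive (n : nat) (x : R) : (2 <= n)%nat ->
  is_derive (fun y => Series (wcoef (sinseq y) (S n))) x
    (Series (wcoef (cosseq x) n)).
Proof.
  intros Hn.
  apply (is_derive_Series (fun k y => wcoef (sinseq y) (S n) k)
    (fun k y => wcoef (cosseq y) n k) (wcoef (fun _ => 1) 2)).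
  - exact ex_series_inv_sqr.
  - intros k y; apply Rabs_wcoef_2; trivial; apply cosseq_bound.
  - intros y; apply ex_series_wcoef; [apply sinseq_bound|lia].
  - intros k y; apply wcoef_sinseq_derive.
Qed.

Lemma cos_series_2_continuity (x : R) :
  continuity_pt (fun y => Series (wcoef (cosseq y) 2)) x.
Proof.
  apply (continuity_Series (fun k y => wcoef (cosseq y) 2 k)
    (wcoef (fun _ => 1) 2)).
  - exact ex_series_inv_sqr.
  - intros k y; apply Rabs_wcoef_2; [apply cosseq_bound|lia].
  - intros k y; apply ex_derive_continuity_pt; eexists.
    apply wcoef_cosseq_derive.
Qed.

(** The classical series with terms [- 2 cos (2 PI k s - n PI / 2) / (2 PI k)^n], its phase resolved
    by the parity of [n]. *)
Definition Fourier (n : nat) (s : R) : R :=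
  - 2 * (-1) ^ Nat.div2 n / (2 * PI) ^ n
  * Series (wcoef (if Nat.even n then cosseq (2 * PI * s)
                   else sinseq (2 * PI * s)) n).

Lemma div2_even_S (n : nat) :
  (Nat.even n = true /\ Nat.even (S n) = false /\
   Nat.div2 (S n) = Nat.div2 n) \/
  (Nat.even n = false /\ Nat.even (S n) = true /\
   Nat.div2 (S n) = S (Nat.div2 n)).
Proof.
  induction n as [|n [[H1 [H2 H3]]|[H1 [H2 H3]]]]; [left; auto|right|left].
  - split; [exact H2|split; [exact H1|simpl in *; now rewrite H3]].
  - split; [exact H2|split; [exact H1|simpl in *; now rewrite H3]].
Qed.

(** [Nat.div2] grows exactly when [S n] is even, and this sign change absorbs the one from
    differentiating cosines. *)
Lemma Fourier_derive (n : nat) (s : R) : (2 <= n)%nat ->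
  is_derive (Fourier (S n)) s (Fourier n s).
Proof.
  intros Hn; assert (HPI := PI_RGT_0); unfold Fourier.
  assert (Hp : (2 * PI) ^ n <> 0) by (apply pow_nonzero; lra).
  assert (Hlin : is_derive (fun t => 2 * PI * t) s (2 * PI))
    by (auto_derive; [trivial|ring]).
  rewrite <- (tech_pow_Rmult (2 * PI)).
  destruct (div2_even_S n) as [[-> [-> ->]]|[-> [-> ->]]].
  - replace (_ * Series _) with (- 2 * (-1) ^ Nat.div2 n / (2 * PI * (2 * PI) ^ n)
      * (2 * PI * Series (wcoef (cosseq (2 * PI * s)) n))) by (field; lra).
    apply (is_derive_scal (fun t => Series (wcoef (sinseq (2 * PI * t)) (S n)))).
    apply (is_derive_comp (fun y => Series (wcoef (sinseq y) (S n))));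
      [now apply sin_series_derive|exact Hlin].
  - rewrite <- (tech_pow_Rmult (-1)).
    replace (_ * Series _)
      with (- 2 * (-1 * (-1) ^ Nat.div2 n) / (2 * PI * (2 * PI) ^ n)
      * (2 * PI * - Series (wcoef (sinseq (2 * PI * s)) n))) by (field; lra).
    apply (is_derive_scal (fun t => Series (wcoef (cosseq (2 * PI * t)) (S n)))).
    apply (is_derive_comp (fun y => Series (wcoef (cosseq y) (S n))));
      [now apply cos_series_derive|exact Hlin].
Qed.

Lemma Fourier_periodic (n : nat) : Fourier n 1 = Fourier n 0.
Proof.
  unfold Fourier; f_equal; apply Series_ext; intros [|k]; trivial.
  unfold wcoef, cosseq, sinseq.
  destruct (Nat.even n); f_equal; rewrite Rmult_0_r, Rmult_0_r, Rmult_1_r.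
  - replace (INR (S k) * (2 * PI)) with (0 + 2 * INR (S k) * PI) by ring.
    apply cos_period.
  - replace (INR (S k) * (2 * PI)) with (0 + 2 * INR (S k) * PI) by ring.
    apply sin_period.
Qed.

Lemma bern_continuity (B : nat -> R -> R) (HB : Bernoulli_polynomials B)
  (n : nat) (s : R) : continuity_pt (bern B (S n)) s.
Proof.
  apply ex_derive_continuity_pt; eexists; now apply bern_derive.
Qed.

(* Integrating over a period kills the constant. *)
Lemma bern_Fourier_const (B : nat -> R -> R) (HB : Bernoulli_polynomials B)
  (n : nat) (c : R) : (2 <= n)%nat ->
  (forall s, 0 <= s <= 1 -> bern B n s = Fourier n s + c) -> c = 0.
Proof.
  intros Hn H.
  assert (Hd := bern_diff B HB (S n)).
  replace (Nat.eqb (S n) 1) with false in Hd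
    by (symmetry; apply Nat.eqb_neq; lia).
  assert (E : bern B (S n) 1 - bern B (S n) 0
    = (Fourier (S n) 1 + c * 1) - (Fourier (S n) 0 + c * 0)).
  { apply (derive_eq_diff _ (fun s => Fourier (S n) s + c * s) (bern B n));
      [lra| | | |].
    - intros s _; now apply bern_derive.
    - intros s Hs; rewrite H by lra.
      apply (is_derive_plus (V := R_NormedModule)); [now apply Fourier_derive|].
      auto_derive; [trivial|ring].
    - intros s _; now apply bern_continuity.
    - intros s _; apply (continuity_pt_plus (Fourier (S n)) (fun s => c * s)).
      + apply ex_derive_continuity_pt; eexists; now apply Fourier_derive.
      + apply ex_derive_continuity_pt; auto_derive; trivial. }
  rewrite Fourier_periodic in E; lra.
Qed.

(** By induction both sides have the same derivative inside the interval, hence agree up to a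
    constant, which [bern_Fourier_const] removes. The base case integrates the sawtooth; continuity
    takes care of the endpoints. *)
Lemma bern_Fourier (B : nat -> R -> R) (HB : Bernoulli_polynomials B)
  (n : nat) (s : R) : (2 <= n)%nat -> 0 <= s <= 1 ->
  bern B n s = Fourier n s.
Proof.
  intros Hn; revert s.
  assert (Hc : exists c, forall s, 0 <= s <= 1 -> bern B n s = Fourier n s + c).
  2:{ destruct Hc as [c Hc]; rewrite (bern_Fourier_const B HB n c Hn Hc) in Hc.
      intros s Hs; rewrite Hc by trivial; ring. }
  induction Hn as [|n Hn [c IH]].
  - exists (bern B 2 0 - Fourier 2 0); intros s Hs.
    cut (bern B 2 s - bern B 2 0 = Fourier 2 s - Fourier 2 0); [lra|].
    apply derive_eq_diff with (bern B 1); [lra| | | |].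
    + intros t _; now apply bern_derive.
    + intros t Ht; rewrite bern_1 by trivial; unfold Fourier; simpl Nat.even.
      simpl Nat.div2; assert (HPI := PI_RGT_0).
      replace (t - 1 / 2) with (- 2 * (-1) ^ 1 / (2 * PI) ^ 2
        * (2 * PI * (- ((PI - 2 * PI * t) / 2)))) by (field; lra).
      apply (is_derive_scal (fun t => Series (wcoef (cosseq (2 * PI * t)) 2))).
      apply (is_derive_comp (fun y => Series (wcoef (cosseq y) 2))).
      * apply cos_series_2_derive; nra.
      * auto_derive; [trivial|ring].
    + intros t _; now apply bern_continuity.
    + intros t _; unfold Fourier; simpl Nat.even.
      apply (continuity_pt_scal (fun t => Series (wcoef (cosseq (2 * PI * t)) 2))).
      apply (continuity_pt_comp (fun t => 2 * PI * t)
        (fun y => Series (wcoef (cosseq y) 2))).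
      * apply ex_derive_continuity_pt; auto_derive; trivial.
      * apply cos_series_2_continuity.
  - exists (bern B (S n) 0 - Fourier (S n) 0); intros s Hs.
    rewrite (bern_Fourier_const B HB n c Hn IH) in IH.
    cut (bern B (S n) s - bern B (S n) 0 = Fourier (S n) s - Fourier (S n) 0);
      [lra|].
    apply derive_eq_diff with (bern B n); [lra| | | |].
    + intros t _; now apply bern_derive.
    + intros t Ht; rewrite IH, Rplus_0_r by lra; now apply Fourier_derive.
    + intros t _; now apply bern_continuity.
    + intros t _; apply ex_derive_continuity_pt; eexists.
      now apply Fourier_derive.
Qed.

(** * Quotients of consecutive Bernoulli polynomials *)

(** For [k >= 2], [k ^ (n + 2) >= 2 ^ n * k ^ 2], so everything after the term [k = 1] is
    [O(2 ^ (- n))]. *)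
Lemma Series_wcoef_lim (u : nat -> R) : (forall j, Rabs (u j) <= 1) ->
  is_lim_seq (fun n => Series (wcoef u (n + 2))) (u 1%nat).
Proof.
  intros Hu; set (M := Series (fun k => wcoef (fun _ => 1) 2 (2 + k))).
  assert (HM : ex_series (fun k => wcoef (fun _ => 1) 2 (2 + k)))
    by apply (ex_series_incr_n (wcoef (fun _ => 1) 2) 2), ex_series_inv_sqr.
  assert (Hb : forall n,
    Rabs (Series (wcoef u (n + 2)) - u 1%nat) <= (1 / 2) ^ n * M).
  { intros n.
    rewrite (Series_incr_n (wcoef u (n + 2)) 2);
      [|lia|apply ex_series_wcoef; [trivial|lia]].
    replace (sum_f_R0 _ _) with (u 1%nat)
      by (cbn [pred sum_f_R0]; unfold wcoef; rewrite INR_1, pow1; field).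
    unfold Rminus; rewrite Rplus_comm, <- Rplus_assoc, Rplus_opp_l, Rplus_0_l.
    assert (Hk : forall k, Rabs (wcoef u (n + 2) (2 + k))
      <= (1 / 2) ^ n * wcoef (fun _ => 1) 2 (2 + k)).
    { intros k; change (2 + k)%nat with (S (S k)); unfold wcoef.
      assert (H1 := INR_S_ge_1 k).
      assert (H2 : 2 <= INR (S (S k))) by (rewrite (S_INR (S k)); lra).
      set (a := INR (S (S k))) in *.
      assert (H3 : 0 < a ^ n) by (apply pow_lt; lra).
      assert (H4 : 0 < a ^ 2) by (apply pow_lt; lra).
      rewrite pow_add.
      unfold Rdiv; rewrite Rabs_mult, Rabs_inv, (Rabs_pos_eq (_ * _)) by nra.
      rewrite Rinv_mult, Rmult_comm, Rmult_assoc, 2!Rmult_1_l.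
      apply Rmult_le_compat; [left; now apply Rinv_0_lt_compat| | |].
      - apply Rmult_le_pos; [left; now apply Rinv_0_lt_compat|apply Rabs_pos].
      - rewrite <- pow_inv; apply pow_incr; split.
        + left; apply Rinv_0_lt_compat; lra.
        + apply Rinv_le_contravar; lra.
      - rewrite <- (Rmult_1_r (/ a ^ 2)) at 2.
        apply Rmult_le_compat_l; [left; now apply Rinv_0_lt_compat|apply Hu]. }
    assert (He : ex_series (fun k => (1 / 2) ^ n * wcoef (fun _ => 1) 2 (2 + k)))
      by now apply (ex_series_scal_l (K := R_AbsRing) (V := R_NormedModule)).
    unfold M; rewrite <- Series_scal_l.
    eapply Rle_trans; [apply Series_Rabs|].
    - apply (ex_series_le (V := R_CompleteNormedModule) _
        (fun k => (1 / 2) ^ n * wcoef (fun _ => 1) 2 (2 + k))); trivial.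
      intros k; unfold norm; simpl norm; unfold abs; simpl abs.
      rewrite Rabs_Rabsolu; apply Hk.
    - apply Series_le; trivial; intros k; split; [apply Rabs_pos|apply Hk]. }
  apply is_lim_seq_ext with
    (fun n => u 1%nat + (Series (wcoef u (n + 2)) - u 1%nat)); [intros; ring|].
  replace (Finite (u 1%nat)) with (Finite (u 1%nat + 0)) by (f_equal; ring).
  apply is_lim_seq_plus'; [apply is_lim_seq_const|].
  apply is_lim_seq_abs_0.
  apply (is_lim_seq_le_le (fun _ => 0) _ (fun n => (1 / 2) ^ n * M)).
  - intros n; split; [apply Rabs_pos|apply Hb].
  - apply is_lim_seq_const.
  - rewrite <- (Rmult_0_l M); apply is_lim_seq_mult'; [|apply is_lim_seq_const].
    apply is_lim_seq_geom; rewrite Rabs_pos_eq; lra.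
Qed.

Lemma div2_even_double (m : nat) :
  Nat.even (2 * m) = true /\ Nat.div2 (2 * m) = m /\
  Nat.even (S (2 * m)) = false /\ Nat.div2 (S (2 * m)) = m.
Proof.
  assert (He : Nat.even (2 * m) = true) by now rewrite Nat.even_mul.
  assert (Hd : Nat.div2 (2 * m) = m) by apply Nat.div2_double.
  destruct (div2_even_S (2 * m)) as [[_ [H1 H2]]|[H1 _]]; [|congruence].
  rewrite H2; auto.
Qed.

Lemma bern_even (B : nat -> R -> R) (HB : Bernoulli_polynomials B)
  (m : nat) (s : R) : 0 < s < 1 / 2 ->
  bern B (2 * S m) s
  = - 2 * (-1) ^ S m / (2 * PI) ^ (2 * S m) * Csum (2 * PI * s) (2 * S m) 1.
Proof.
  intros Hs; rewrite bern_Fourier by (trivial; lra || lia).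
  unfold Fourier; destruct (div2_even_double (S m)) as [-> [-> _]].
  now rewrite Csum_1 by lia.
Qed.

Lemma bern_odd (B : nat -> R -> R) (HB : Bernoulli_polynomials B)
  (m : nat) (s : R) : 0 < s < 1 / 2 ->
  bern B (S (2 * m)) s
  = - 2 * (-1) ^ m / (2 * PI) ^ S (2 * m) * Ssum (2 * PI * s) (S (2 * m)) 1.
Proof.
  intros Hs; assert (HPI := PI_RGT_0); destruct m as [|m].
  (* Index 1 is outside the range of [bern_Fourier]; the closed form of the sawtooth replaces it. *)
  - change (S (2 * 0)) with 1%nat.
    rewrite bern_1, Ssum_1_1 by (trivial; nra); simpl; field; lra.
  - rewrite bern_Fourier by (trivial; lra || lia).
    unfold Fourier; destruct (div2_even_double (S m)) as [_ [_ [-> ->]]].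
    now rewrite Ssum_1 by lia.
Qed.

(** The quotient [b_(2l) / b_(2l-1)] for [l = m + 1]; the shift avoids subtraction in the
    indices. *)
Definition bratio (B : nat -> R -> R) (m : nat) (s : R) : R :=
  bern B (2 * S m) s / bern B (S (2 * m)) s.

Lemma quotient_bratio (B : nat -> R -> R) (m : nat) (s : R) :
  B (2 * S m)%nat s / B (2 * S m - 1)%nat s = 2 * INR (S m) * bratio B m s.
Proof.
  unfold bratio, bern; replace (2 * S m - 1)%nat with (S (2 * m)) by lia.
  replace (fact (2 * S m)) with ((2 * S m) * fact (S (2 * m)))%nat.
  2:{ replace (2 * S m)%nat with (S (S (2 * m))) by lia.
      now rewrite (fact_simpl (S (2 * m))). }
  rewrite mult_INR, (mult_INR 2 (S m)); simpl (INR 2).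
  assert (Hf := INR_fact_neq_0 (S (2 * m))); assert (Hm := INR_S_ge_1 m).
  (* At a zero of the denominator both sides are 0, because [/ 0 = 0]; the identity thus holds for
     every [s]. *)
  destruct (Req_dec (B (S (2 * m)) s) 0) as [H|H].
  - rewrite H; unfold Rdiv; rewrite Rmult_0_l, Rinv_0; ring.
  - field; repeat split; lra.
Qed.

Lemma quotient_INR_bratio (B : nat -> R -> R) (m : nat) (s : R) :
  B (2 * S m)%nat s / (INR (S m) * B (2 * S m - 1)%nat s) = 2 * bratio B m s.
Proof.
  assert (Hm := INR_S_ge_1 m).
  unfold Rdiv; rewrite Rinv_mult, (Rmult_comm (/ _)), <- Rmult_assoc.
  fold (B (2 * S m)%nat s / B (2 * S m - 1)%nat s).
  rewrite quotient_bratio; field; lra.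
Qed.

Lemma bern_odd_sign (B : nat -> R -> R) (HB : Bernoulli_polynomials B)
  (m : nat) (s : R) : 0 < s < 1 / 2 -> 0 < (-1) ^ S m * bern B (S (2 * m)) s.
Proof.
  intros Hs; assert (HPI := PI_RGT_0).
  rewrite bern_odd by trivial; set (N := S (2 * m)).
  assert (HS : 0 < Ssum (2 * PI * s) N 1) by (apply Ssum_pos; nra).
  assert (Hp : 0 < (2 * PI) ^ N) by (apply pow_lt; lra).
  assert (H1 : (-1) ^ m * (-1) ^ m = 1)
    by (rewrite <- Rpow_mult_distr, <- (pow1 m); f_equal; ring).
  rewrite <- tech_pow_Rmult.
  replace (-1 * (-1) ^ m * (- 2 * (-1) ^ m / (2 * PI) ^ N
    * Ssum (2 * PI * s) N 1))
    with ((-1) ^ m * (-1) ^ m * 2 / (2 * PI) ^ N * Ssum (2 * PI * s) N 1)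
    by (field; lra).
  rewrite H1; apply Rmult_lt_0_compat; trivial.
  apply Rdiv_lt_0_compat; lra.
Qed.

Lemma bratio_Csum_Ssum (B : nat -> R -> R) (HB : Bernoulli_polynomials B)
  (m : nat) (s : R) : 0 < s < 1 / 2 ->
  bratio B m s = - / (2 * PI)
    * (Csum (2 * PI * s) (2 * S m) 1 / Ssum (2 * PI * s) (S (2 * m)) 1).
Proof.
  intros Hs; assert (HPI := PI_RGT_0); unfold bratio.
  rewrite bern_odd, bern_even by trivial.
  assert (HS : 0 < Ssum (2 * PI * s) (S (2 * m)) 1) by (apply Ssum_pos; nra).
  assert (H1 : (-1) ^ m <> 0) by (apply pow_nonzero; lra).
  assert (Hp : 0 < (2 * PI) ^ S (2 * m)) by (apply pow_lt; lra).
  set (C := Csum _ _ _); set (S' := Ssum _ _ _) in *.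
  replace ((2 * PI) ^ (2 * S m)) with (2 * PI * (2 * PI) ^ S (2 * m))
    by (rewrite tech_pow_Rmult; f_equal; lia).
  rewrite <- (tech_pow_Rmult (-1)); field; repeat split; lra.
Qed.

(** Raising [m] by one raises the index by two, hence two uses of [Csum_Ssum_step]; the factor
    [- / (2 * PI)] reverses the inequality. *)
Lemma bratio_decr (B : nat -> R -> R) (HB : Bernoulli_polynomials B)
  (m : nat) (s : R) : 0 < s < 1 / 2 -> bratio B (S m) s < bratio B m s.
Proof.
  intros Hs; assert (HPI := PI_RGT_0); rewrite !bratio_Csum_Ssum by trivial.
  assert (Hx : 0 < 2 * PI * s < PI) by nra.
  assert (H1 := Csum_Ssum_step (2 * PI * s) (S (2 * m)) Hx).
  assert (H2 := Csum_Ssum_step (2 * PI * s) (S (S (2 * m))) Hx).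
  replace (2 * S m)%nat with (S (S (2 * m))) by lia.
  replace (2 * S (S m))%nat with (S (S (S (S (2 * m))))) by lia.
  assert (Hi : 0 < / (2 * PI)) by (apply Rinv_0_lt_compat; lra); nra.
Qed.

Lemma bratio_lim (B : nat -> R -> R) (HB : Bernoulli_polynomials B) (s : R) :
  0 < s < 1 / 2 ->
  is_lim_seq (fun m => 2 * bratio B m s) (- (cot (2 * PI * s) / PI)).
Proof.
  intros Hs; assert (HPI := PI_RGT_0).
  assert (Hx : 0 < 2 * PI * s < PI) by nra.
  set (x := 2 * PI * s) in *; destruct (cos_sin_open x Hx) as [Hsin _].
  (* The term [m = 0] is dropped, since its denominator has index 1 and is not covered by
     [Ssum_1]. *)
  apply is_lim_seq_incr_1.
  apply is_lim_seq_ext with (fun m => - / PI *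
    (Series (wcoef (cosseq x) (2 * S m + 2))
     / Series (wcoef (sinseq x) (S (2 * m) + 2)))).
  { intros m; rewrite bratio_Csum_Ssum by trivial; fold x.
    replace (2 * S (S m))%nat with (2 * S m + 2)%nat by lia.
    replace (S (2 * S m))%nat with (S (2 * m) + 2)%nat by lia.
    assert (HS := Ssum_pos x (S (2 * m) + 2) Hx).
    rewrite Csum_1, Ssum_1 in * by lia; field; lra. }
  replace (- (cot x / PI)) with (- / PI * (cosseq x 1 / sinseq x 1)).
  2:{ unfold cot, cosseq, sinseq; simpl; rewrite !Rmult_1_l; field; lra. }
  apply is_lim_seq_mult'; [apply is_lim_seq_const|].
  apply is_lim_seq_div'.
  - apply (is_lim_seq_subseq (fun n => Series (wcoef (cosseq x) (n + 2))) _
      (fun m => (2 * S m)%nat)).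
    + apply eventually_subseq; intros n; lia.
    + apply Series_wcoef_lim, cosseq_bound.
  - apply (is_lim_seq_subseq (fun n => Series (wcoef (sinseq x) (n + 2))) _
      (fun m => S (2 * m))).
    + apply eventually_subseq; intros n; lia.
    + apply Series_wcoef_lim, sinseq_bound.
  - unfold sinseq; simpl; rewrite Rmult_1_l; lra.
Qed.

Lemma bratio_reflection (B : nat -> R -> R) (HB : Bernoulli_polynomials B)
  (m : nat) (s : R) : bratio B m s = - bratio B m (1 - s).
Proof.
  unfold bratio; rewrite !bern_reflection by trivial.
  replace ((-1) ^ (2 * S m)) with 1 by (symmetry; apply pow_1_even).
  replace ((-1) ^ S (2 * m)) with (-1) by (symmetry; apply pow_1_odd).
  destruct (Req_dec (bern B (S (2 * m)) s) 0) as [H|H].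
  - rewrite H, Rmult_0_r; unfold Rdiv; rewrite Rinv_0; ring.
  - field; trivial.
Qed.

(** For positive index, [b_(2m+1)] vanishes at 0 and [1 / 2] by reflection, so its derivative
    [b_(2m)] has a zero [c] in between. From [c] to [1 / 2] the change of [b_(2m)] has the sign of
    [b_(2m-1)], known from [bern_odd_sign]. *)
Lemma bern_even_half (B : nat -> R -> R) (HB : Bernoulli_polynomials B)
  (m : nat) : 0 < (-1) ^ m * bern B (2 * m) (1 / 2).
Proof.
  destruct m as [|m]; [simpl; rewrite bern_0 by trivial; lra|].
  set (sg := (-1) ^ S m).
  assert (E1 : bern B (S (2 * S m)) (1 / 2) = 0).
  { assert (H := bern_reflection B HB (S (2 * S m)) (1 / 2)).
    rewrite pow_1_odd in H; replace (1 - 1 / 2) with (1 / 2) in H by field; lra. }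
  assert (E0 : bern B (S (2 * S m)) 0 = 0).
  { assert (H := bern_reflection B HB (S (2 * S m)) 0).
    assert (H' := bern_diff B HB (S (2 * S m))).
    replace (Nat.eqb _ 1) with false in H'
      by (symmetry; apply Nat.eqb_neq; lia).
    rewrite pow_1_odd, Rminus_0_r in H; lra. }
  destruct (MVT_cor2 (bern B (S (2 * S m))) (bern B (2 * S m)) 0 (1 / 2))
    as [c [Hc1 Hc]]; [lra| |].
  { intros c _; apply is_derive_Reals; now apply bern_derive. }
  assert (Hc0 : bern B (2 * S m) c = 0) by (rewrite E1, E0 in Hc1; lra).
  destruct (MVT_cor2 (bern B (2 * S m)) (bern B (S (2 * m))) c (1 / 2))
    as [d [Hd1 Hd]]; [lra| |].
  { intros y _; apply is_derive_Reals.
    replace (2 * S m)%nat with (S (S (2 * m))) by lia; now apply bern_derive. }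
  assert (Hs := bern_odd_sign B HB m d ltac:(lra)); fold sg in Hs.
  rewrite Hc0, Rminus_0_r in Hd1; rewrite Hd1, <- Rmult_assoc.
  apply Rmult_lt_0_compat; lra.
Qed.

(** * Turan determinants and monotonicity in [s] *)

Definition turan (B : nat -> R -> R) (m : nat) (s : R) : R :=
  bern B (S (2 * m)) s * bern B (S (2 * m)) s
  - bern B (S (S (2 * m))) s * bern B (2 * m) s.

Lemma sign_mult_neg (m : nat) (a b : R) :
  0 < (-1) ^ S m * a -> 0 < (-1) ^ m * b -> a * b < 0.
Proof.
  intros Ha Hb; assert (H1 : (-1) ^ m * (-1) ^ m = 1)
    by (rewrite <- Rpow_mult_distr, <- (pow1 m); f_equal; ring).
  assert (H := Rmult_lt_0_compat _ _ Ha Hb).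
  replace (_ * _ * _) with (- (((-1) ^ m * (-1) ^ m) * (a * b))) in H
    by (simpl; ring).
  rewrite H1 in H; lra.
Qed.

(** For [m > 0] the derivative is [b_(2m+1) b_(2m) - b_(2m+2) b_(2m-1)], that is
    [b_(2m+1) b_(2m-1)], which is negative, times a difference of quotients made positive by
    [bratio_decr]. For [m = 0] it is [b_1]; the existential covers both forms. *)
Lemma turan_derive (B : nat -> R -> R) (HB : Bernoulli_polynomials B)
  (m : nat) (s : R) :
  exists d, is_derive (turan B m) s d /\ (0 < s < 1 / 2 -> d < 0).
Proof.
  assert (Hmul : forall f g f' g' : _, is_derive f s f' -> is_derive g s g' ->
    is_derive (fun t => f t * g t) s (f' * g s + f s * g')).
  { intros f g f' g' Hf Hg.
    exact (is_derive_mult (K := R_AbsRing) f g s f' g' Hf Hg Rmult_comm). }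
  unfold turan; destruct m as [|m].
  - eexists; split.
    + apply (is_derive_minus (V := R_NormedModule)).
      * apply (Hmul (bern B 1) (bern B 1)); now apply bern_derive.
      * apply (is_derive_ext (bern B 2)).
        { intros t; change (2 * 0)%nat with 0%nat.
          rewrite (bern_0 B HB t); real_eq; ring. }
        now apply bern_derive.
    + intros Hs; unfold minus, plus, opp; simpl.
      rewrite bern_0, bern_1 by trivial; lra.
  - eexists; split.
    + apply (is_derive_minus (V := R_NormedModule)).
      * apply (Hmul (bern B _) (bern B _)); now apply bern_derive.
      * apply (Hmul (bern B _) (bern B _)); [now apply bern_derive|].
        replace (2 * S m)%nat with (S (S (2 * m))) by lia; now apply bern_derive.
    + intros Hs.
      assert (Hr := bratio_decr B HB m s Hs); unfold bratio in Hr.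
      assert (P0 := bern_odd_sign B HB m s Hs).
      assert (P1 := bern_odd_sign B HB (S m) s Hs).
      replace (2 * S (S m))%nat with (S (S (S (S (2 * m))))) in * by lia.
      replace (2 * S m)%nat with (S (S (2 * m))) in * by lia.
      assert (Hneg := sign_mult_neg (S m) _ _ P1 P0).
      set (b1 := bern B (S (2 * m)) s) in *.
      set (b2 := bern B (S (S (2 * m))) s) in *.
      set (b3 := bern B (S (S (S (2 * m)))) s) in *.
      set (b4 := bern B (S (S (S (S (2 * m))))) s) in *.
      assert (N1 : b1 <> 0) by nra; assert (N3 : b3 <> 0) by nra.
      assert (E : b3 * b2 - b4 * b1 = (b3 * b1) * (b2 / b1 - b4 / b3))
        by (field; split; trivial).
      change (b2 * b3 + b3 * b2 - (b3 * b2 + b4 * b1) < 0); nra.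
Qed.

(** The determinant exceeds its value at [1 / 2], which is positive because consecutive even-index
    values there have opposite signs. *)
Lemma turan_pos (B : nat -> R -> R) (HB : Bernoulli_polynomials B)
  (m : nat) (s : R) : 0 < s < 1 / 2 -> 0 < turan B m s.
Proof.
  intros Hs.
  destruct (MVT_cor2 (turan B m) (Derive (turan B m)) s (1 / 2))
    as [c [Hc1 Hc]]; [lra| |].
  { intros c _; apply is_derive_Reals, Derive_correct.
    destruct (turan_derive B HB m c) as [d [Hd _]]; now exists d. }
  destruct (turan_derive B HB m c) as [d [Hd Hneg]].
  rewrite (is_derive_unique _ _ _ Hd) in Hc1; specialize (Hneg ltac:(lra)).
  assert (H1 := bern_even_half B HB (S m)); assert (H0 := bern_even_half B HB m).
  assert (H := sign_mult_neg m _ _ H1 H0).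
  assert (Hhalf : 0 < turan B m (1 / 2)).
  { unfold turan; replace (S (S (2 * m))) with (2 * S m)%nat by lia.
    generalize (Rle_0_sqr (bern B (S (2 * m)) (1 / 2))); unfold Rsqr; lra. }
  nra.
Qed.

Lemma bratio_incr (B : nat -> R -> R) (HB : Bernoulli_polynomials B) (m : nat) :
  strictly_increasing_on 0 (1 / 2) (bratio B m).
Proof.
  intros x y Hx Hxy Hy.
  assert (N : forall c, 0 < c < 1 / 2 -> bern B (S (2 * m)) c <> 0).
  { intros c Hc H; assert (P := bern_odd_sign B HB m c Hc); rewrite H in P; lra. }
  destruct (MVT_cor2 (bratio B m)
    (fun s => turan B m s / (bern B (S (2 * m)) s) ^ 2) x y Hxy)
    as [c [Hc1 Hc]].
  - intros c Hc; apply is_derive_Reals; unfold bratio, turan.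
    replace (2 * S m)%nat with (S (S (2 * m))) by lia.
    rewrite (Rmult_comm (bern B (S (S _)) c)).
    rewrite (Rmult_comm (bern B (2 * m) c)).
    apply is_derive_div; [now apply bern_derive|now apply bern_derive|].
    apply N; lra.
  - apply Rminus_lt_0; rewrite Hc1; apply Rmult_lt_0_compat; [|lra].
    apply Rdiv_lt_0_compat; [apply turan_pos; trivial; lra|].
    apply pow2_gt_0, N; lra.
Qed.

Lemma cot_reflection (s : R) : cot (2 * PI * (1 - s)) = - cot (2 * PI * s).
Proof.
  unfold cot; replace (2 * PI * (1 - s)) with (- (2 * PI * s) + 2 * INR 1 * PI)
    by (simpl; ring).
  rewrite cos_period, sin_period, cos_neg, sin_neg.
  unfold Rdiv; rewrite Rinv_opp; ring.
Qed.

Theorem theorem4p3 (B : nat -> R -> R) (HB : Bernoulli_polynomials B) :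
  (forall l : nat, (1 <= l)%nat ->
     strictly_increasing_on 0 (1 / 2)
       (fun s => B (2 * l)%nat s / B (2 * l - 1)%nat s) /\
     strictly_increasing_on (1 / 2) 1
       (fun s => B (2 * l)%nat s / B (2 * l - 1)%nat s)) /\
  (forall s : R, 0 < s < 1 / 2 ->
     (forall l : nat, (1 <= l)%nat ->
        B (2 * (l + 1))%nat s / (INR (l + 1) * B (2 * (l + 1) - 1)%nat s)
        < B (2 * l)%nat s / (INR l * B (2 * l - 1)%nat s)) /\
     is_lim_seq (fun l => B (2 * l)%nat s / (INR l * B (2 * l - 1)%nat s))
       (Finite (- (cot (2 * PI * s) / PI)))) /\
  (forall s : R, 1 / 2 < s < 1 ->
     (forall l : nat, (1 <= l)%nat ->
        B (2 * l)%nat s / (INR l * B (2 * l - 1)%nat s)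
        < B (2 * (l + 1))%nat s / (INR (l + 1) * B (2 * (l + 1) - 1)%nat s)) /\
     is_lim_seq (fun l => B (2 * l)%nat s / (INR l * B (2 * l - 1)%nat s))
       (Finite (- (cot (2 * PI * s) / PI)))).
Proof.
  split; [|split].
  - intros [|m] Hl; [lia|]; assert (Hm := INR_S_ge_1 m).
    split; intros x y Hx Hxy Hy; cbv beta; rewrite !quotient_bratio;
      apply Rmult_lt_compat_l; try lra.
    + now apply bratio_incr.
    (* Reflection and negation each reverse the order, so together they preserve it. *)
    + rewrite (bratio_reflection B HB m x), (bratio_reflection B HB m y).
      apply Ropp_lt_contravar, bratio_incr; trivial; lra.
  - intros s Hs; split.
    + intros [|m] Hl; [lia|]; rewrite Nat.add_1_r, !quotient_INR_bratio.
      generalize (bratio_decr B HB m s Hs); lra.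
    (* The shift discards [l = 0], where the quotient has a zero denominator. *)
    + apply is_lim_seq_incr_1.
      apply is_lim_seq_ext with (fun m => 2 * bratio B m s).
      * intros m; now rewrite quotient_INR_bratio.
      * now apply bratio_lim.
  - intros s Hs; assert (Hs' : 0 < 1 - s < 1 / 2) by lra; split.
    + intros [|m] Hl; [lia|]; rewrite Nat.add_1_r, !quotient_INR_bratio.
      rewrite (bratio_reflection B HB m s), (bratio_reflection B HB (S m) s).
      generalize (bratio_decr B HB m (1 - s) Hs'); lra.
    + apply is_lim_seq_incr_1.
      apply is_lim_seq_ext with (fun m => - (2 * bratio B m (1 - s))).
      * intros m; rewrite quotient_INR_bratio, (bratio_reflection B HB m s); ring.
      (* The cotangent changes sign under the reflection as [bratio] does, so the limit keeps the
         same formula. *)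
      * replace (cot (2 * PI * s)) with (- cot (2 * PI * (1 - s)))
          by (rewrite cot_reflection; ring).
        replace (Finite _) with (Rbar_opp (- (cot (2 * PI * (1 - s)) / PI))).
        -- apply -> is_lim_seq_opp; now apply bratio_lim.
        -- simpl; f_equal; unfold Rdiv; ring.
Qed.
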